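(* Let $(M,g)$ be a time-orientable Lorentzian surface. Then the following assertions are equivalent: (i) $(M,g)$ is $\mathcal{X}$-conformally flat. (ii) There exists a global section $s=(s_1,s_2):M\to P$ of the orthonormal frame bundle such that $\mathrm{div}(X_s)=0$. (iii) There exists a (global, nowhere vanishing) $\mathcal{X}$-vector field $X$ such that $\mathrm{div}(X)=0$. (iv) There exists a global section $s=(s_1,s_2):M\to P$ such that $\nabla^{LC}_{X_s}s_i=0$ for $i=1,2$. (v) There exists a positive harmonic spinor without zeros (for some Spin structure on $M$). (vi) There exists a negative twistor spinor without zeros (for some Spin structure on $M$).
   Context: A Lorentzian surface $(M,g)$ is a smooth oriented $2$-manifold with a metric of signature $(1,1)$; in an orthonormal basis $(s_1,s_2)$ the vector $s_1$ is timelike ($g(s_1,s_1)=-1$) and $s_2$ is spacelike ($g(s_2,s_2)=1$). It is time-orientable if it admits a nowhere vanishing timelike vector field (equivalently a global orthonormal frame). The light cone consists of two one-dimensional lightlike distributions $\mathcal{X},\mathcal{Y}$: a lightlike vector $v$ lies in $\mathcal{X}$ iff there is a lightlike $w$ such that $(v,w)$ is an oriented basis and $v+w$ is spacelike; the other distribution is $\mathcal{Y}$. For an oriented orthonormal frame $s=(s_1,s_2)$ put $X_s=s_1+s_2$ (an $\mathcal{X}$-vector field) and $Y_s=-s_1+s_2$ (a $\mathcal{Y}$-vector field). $P$ is the bundle of oriented orthonormal frames and $\nabla^{LC}$ the Levi-Civita connection. By definition, a time-orientable $(M,g)$ is $\mathcal{X}$-conformally flat if there is a global orthonormal frame $s$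 with $\mathrm{div}(X_s)=0$. The spinor bundle $S=Q\times_{Spin}\Delta_{1,1}$, $\Delta_{1,1}=\mathbb{C}^2$, uses the Clifford representation $e_1\mapsto\begin{pmatrix}0&i\\-i&0\end{pmatrix}$, $e_2\mapsto\begin{pmatrix}0&i\\i&0\end{pmatrix}$ (so $v\cdot v=-g(v,v)$). $S^{+}$ and $S^{-}$ are the eigenbundles of $\omega=s_1\cdot s_2$ for the eigenvalues $-1$ and $+1$ respectively; sections of $S^\pm$ are called positive/negative spinors. With $\nabla^S$ the spinor connection induced by the Levi-Civita connection, $D\varphi=-s_1\cdot\nabla^S_{s_1}\varphi+s_2\cdot\nabla^S_{s_2}\varphi$. A spinor $\varphi$ is harmonic if $D\varphi=0$, and twistor if $\nabla^S_V\varphi=-\tfrac12V\cdot D\varphi$ for all vector fields $V$. *)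

(* Defs.v *)
From HB Require Import structures.
From mathcomp Require Export all_boot all_order all_algebra.
From mathcomp Require Export all_classical all_reals all_analysis.
From mathcomp Require Export complex.

Set Implicit Arguments.
Unset Strict Implicit.
Unset Printing Implicit Defensive.

Import Order.TTheory GRing.Theory Num.Theory.
Import numFieldNormedType.Exports.

Local Open Scope classical_set_scope.
Local Open Scope ring_scope.

Section Smooth.
Context {R : realType} {V W : normedModType R}.

Fixpoint Ck_on (k : nat) (U : set V) (f : V -> W) : Prop :=
  match k with
  | 0 => forall x, U x -> {for x, continuous f}
  | k'.+1 => (forall x, U x -> differentiable f x) /\
             (forall v, Ck_on k' U ('D_v f))
  end.

Definition smooth_on (U : set V) (f : V -> W) : Prop :=
  forall k, Ck_on k U f.

End Smooth.

Definition basis_vec (R : realType) (a : 'I_2) : 'rV[R]_2 := delta_mx 0 a.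

(* The orientation is the one given by the atlas, all of whose transition maps
   have positive Jacobian.  [phi c] is only meaningful on [dom c], and [psi c]
   (the inverse chart) on [phi c @` dom c].  [chart_at] picks a chart around
   each point; it is used to evaluate chart-independent expressions. *)
Record surface (R : realType) := Surface {
  point :> topologicalType;
  surface_hausdorff : hausdorff_space point;
  surface_second_countable : @second_countable point;
  chart : Type;
  dom : chart -> set point;
  phi : chart -> point -> 'rV[R]_2;
  psi : chart -> 'rV[R]_2 -> point;
  chart_at : point -> chart;
  dom_chart_at : forall x, dom (chart_at x) x;
  dom_open : forall c, open (dom c);
  phi_open : forall c, open (phi c @` dom c);
  phiK : forall c x, dom c x -> psi c (phi c x) = x;
  phi_continuous : forall c x, dom c x -> {for x, continuous (phi c)};
  psi_continuous : forall c y, (phi c @` dom c) y -> {for y, continuous (psi c)};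
  transition_smooth : forall c d,
    smooth_on (phi c @` (dom c `&` dom d)) (phi d \o psi c);
  transition_oriented : forall c d x, dom c x -> dom d x ->
    0 < \det (\matrix_(a < 2) 'D_(basis_vec R a) (phi d \o psi c) (phi c x))
}.

Section Surface.
Context {R : realType} (M : surface R).

(* A tangent vector is the family of its components in all charts (transforming
   by the differentials of the transition maps), with value 0 at the charts that
   do not contain the base point; so equality of tangent vectors is Leibniz
   equality and the linear structure is the pointwise one. *)
Definition components := chart M -> 'rV[R]_2.

Definition dtransition (c d : chart M) (x : M) (u : 'rV[R]_2) : 'rV[R]_2 :=
  'D_u (phi d \o psi c) (phi c x).

Definition tangent (x : M) : set components :=
  [set v | (forall c d, dom c x -> dom d x -> v d = dtransition c d x (v c)) /\
           (forall c, ~ dom c x -> v c = 0)].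

(* the tangent vector at x with components u in the chart c *)
Definition of_components (c : chart M) (x : M) (u : 'rV[R]_2) : components :=
  fun d => if `[< dom d x >] then dtransition c d x u else 0.

Definition smooth_fun_on {W : normedModType R} (U : set M) (f : M -> W) : Prop :=
  forall c, smooth_on (phi c @` (dom c `&` U)) (f \o psi c).

Definition csmooth_on {m n : nat} (U : set M) (f : M -> 'M[R[i]]_(m, n)) : Prop :=
  forall i j, smooth_fun_on U (fun x => complex.Re (f x i j)) /\
              smooth_fun_on U (fun x => complex.Im (f x i j)).

Definition vector_field_on (U : set M) (V : M -> components) : Prop :=
  (forall x, U x -> tangent x (V x)) /\
  (forall c, smooth_on (phi c @` (dom c `&` U)) (fun y => V (psi c y) c)).

Definition vector_field (V : M -> components) : Prop := vector_field_on setT V.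

(* derivative of f at x in the direction of the tangent vector v at x *)
Definition dirderiv (f : M -> R) (v : components) (x : M) : R :=
  'D_(v (chart_at x)) (f \o psi (chart_at x)) (phi (chart_at x) x).

Definition cdirderiv {n : nat} (f : M -> 'cV[R[i]]_n) (v : components) (x : M)
    : 'cV[R[i]]_n :=
  \col_i (dirderiv (fun z => complex.Re (f z i 0)) v x
          +i* dirderiv (fun z => complex.Im (f z i 0)) v x)%C.

Definition positively_oriented (x : M) (v w : components) : Prop :=
  0 < \det (\matrix_(i < 2)
              (if i == 0 then v (chart_at x) else w (chart_at x))).

(* [G x c] is the Gram matrix of a metric at x in the chart c *)
Definition inner (G : M -> chart M -> 'M[R]_2) (x : M) (v w : components) : R :=
  (v (chart_at x) *m G x (chart_at x) *m (w (chart_at x))^T) 0 0.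

Record lorentz_metric := LorentzMetric {
  gram :> M -> chart M -> 'M[R]_2;
  gram_sym : forall x c, dom c x -> (gram x c)^T = gram x c;
  gram_transition : forall x c d, dom c x -> dom d x -> forall u w,
    u *m gram x c *m w^T =
    dtransition c d x u *m gram x d *m (dtransition c d x w)^T;
  gram_smooth : forall c a b,
    smooth_on (phi c @` dom c) (fun y => gram (psi c y) c a b);
  gram_signature : forall x, exists v w, [/\ tangent x v, tangent x w,
    inner gram x v v = -1, inner gram x w w = 1 & inner gram x v w = 0]
}.

End Surface.

Section Lorentz.
Context {R : realType} {M : surface R} (g : lorentz_metric M).

Definition timelike (x : M) (v : components M) : Prop := inner g x v v < 0.
Definition spacelike (x : M) (v : components M) : Prop := 0 < inner g x v v.
Definition lightlike (x : M) (v : components M) : Prop :=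
  v <> 0 /\ inner g x v v = 0.

Definition time_orientable : Prop :=
  exists T : M -> components M, vector_field T /\ forall x, timelike x (T x).

Definition Xdistribution (x : M) : set (components M) :=
  [set v | v = 0 \/
    [/\ tangent x v, lightlike x v &
        exists w, [/\ tangent x w, lightlike x w, positively_oriented x v w &
                      spacelike x (v + w)]]].

Definition nonvanishing_Xfield (X : M -> components M) : Prop :=
  vector_field X /\ forall x, Xdistribution x (X x) /\ X x <> 0.

Definition frame : Type := (components M * components M)%type.

(* the fibre over x of the bundle P of oriented orthonormal frames *)
Definition Pfibre (x : M) : set frame :=
  [set s | [/\ tangent x s.1, tangent x s.2 & positively_oriented x s.1 s.2] /\
           [/\ inner g x s.1 s.1 = -1, inner g x s.2 s.2 = 1 &
               inner g x s.1 s.2 = 0]].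

Definition frame_section_on (U : set M) (s : M -> frame) : Prop :=
  [/\ forall x, U x -> Pfibre x (s x),
      vector_field_on U (fun x => (s x).1) &
      vector_field_on U (fun x => (s x).2)].

Definition frame_section (s : M -> frame) : Prop := frame_section_on setT s.

Definition Xof (s : M -> frame) : M -> components M :=
  fun x => (s x).1 + (s x).2.

Definition dgram (c : chart M) (x : M) (a b d : 'I_2) : R :=
  'D_(basis_vec R a) (fun y => g (psi c y) c b d) (phi c x).

(* Christoffel symbol with upper index e and lower indices a, b *)
Definition christoffel (c : chart M) (x : M) (e a b : 'I_2) : R :=
  2^-1 * \sum_(d < 2) invmx (g x c) e d *
           (dgram c x a b d + dgram c x b a d - dgram c x d a b).

(* components in the chart c of the Levi-Civita derivative of W at x along the
   vector with components u *)
Definition cov (c : chart M) (u : 'rV[R]_2) (W : M -> components M) (x : M)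
    : 'rV[R]_2 :=
  \row_e ('D_u (fun y => W (psi c y) c 0 e) (phi c x) +
          \sum_(a < 2) \sum_(b < 2) christoffel c x e a b * u 0 a * W x c 0 b).

Definition nablaLC (v : components M) (W : M -> components M) (x : M)
    : components M :=
  of_components (chart_at x) x (cov (chart_at x) (v (chart_at x)) W x).

(* trace of v |-> nablaLC v V *)
Definition divergence (V : M -> components M) (x : M) : R :=
  \sum_(a < 2) cov (chart_at x) (basis_vec R a) V x 0 a.

Definition X_conformally_flat : Prop :=
  time_orientable /\
  exists s, frame_section s /\ forall x, divergence (Xof s) x = 0.

End Lorentz.

Section Clifford.
Context {R : realType}.

Definition spinor_module := 'cV[R[i]]_2.

Definition cl1 : 'M[R[i]]_2 := 'i%C *: delta_mx 0 1 - 'i%C *: delta_mx 1 0.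
Definition cl2 : 'M[R[i]]_2 := 'i%C *: delta_mx 0 1 + 'i%C *: delta_mx 1 0.
Definition clomega : 'M[R[i]]_2 := cl1 *m cl2.

Definition clifford (v : 'cV[R]_2) : 'M[R[i]]_2 :=
  (v 0 0)%:C%C *: cl1 + (v 1 0)%:C%C *: cl2.

Definition minkowski (v : 'cV[R]_2) : R := - v 0 0 ^+ 2 + v 1 0 ^+ 2.

(* The representation of the real Clifford algebra on 'M[R[i]]_2 is faithful,
   so Spin(1,1) is given by its image: products of an even number of vectors of
   square 1 or -1.  It is a double cover of the whole of SO(1,1). *)
Definition Spin : set 'M[R[i]]_2 :=
  [set a | exists vs : seq 'cV[R]_2,
     [/\ ~~ odd (size vs),
         forall v, v \in vs -> minkowski v = 1 \/ minkowski v = -1 &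
         a = \prod_(v <- vs) clifford v]].

(* A is the image of a under the covering map Spin(1,1) -> SO(1,1) *)
Definition spin_cover (a : 'M[R[i]]_2) (A : 'M[R]_2) : Prop :=
  forall v, clifford (A *m v) = a *m clifford v *m invmx a.

End Clifford.

Section SpinStructure.
Context {R : realType} {M : surface R} (g : lorentz_metric M).

Definition frame_act (s : @frame R M) (A : 'M[R]_2) : frame :=
  (A 0 0 *: s.1 + A 1 0 *: s.2, A 0 1 *: s.1 + A 1 1 *: s.2).

(* A principal Spin(1,1)-bundle Q -> M together with an equivariant bundle map
   Q -> P.  The smooth structure of Q is given by the local sections [sigma k]
   over the open sets [triv k], with smooth transition functions. *)
Record spin_structure := SpinStructure {
  Q : Type;
  pr : Q -> M;
  act : Q -> 'M[R[i]]_2 -> Q;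
  act1 : forall q, act q 1%:M = q;
  actM : forall q a b, Spin a -> Spin b -> act (act q a) b = act q (a *m b);
  pr_act : forall q a, Spin a -> pr (act q a) = pr q;
  act_simply_transitive : forall q q', pr q = pr q' ->
    exists! a, Spin a /\ act q a = q';
  triv_index : Type;
  triv : triv_index -> set M;
  sigma : triv_index -> M -> Q;
  triv_open : forall k, open (triv k);
  triv_cover : forall x, exists k, triv k x;
  pr_sigma : forall k x, triv k x -> pr (sigma k x) = x;
  sigma_transition : forall k l, exists a : M -> 'M[R[i]]_2,
    csmooth_on (triv k `&` triv l) a /\
    forall x, triv k x -> triv l x ->
      Spin (a x) /\ sigma l x = act (sigma k x) (a x);
  Lambda : Q -> frame;
  Lambda_fibre : forall q, Pfibre g (pr q) (Lambda q);
  Lambda_equivariant : forall q a, Spin a ->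
    exists A, spin_cover a A /\ Lambda (act q a) = frame_act (Lambda q) A;
  Lambda_smooth : forall k, frame_section_on g (triv k) (Lambda \o sigma k)
}.

End SpinStructure.

Section Spinors.
Context {R : realType} {M : surface R} {g : lorentz_metric M}.
Variable Sp : spin_structure g.

(* the class [q, w] in the associated bundle of Q with fibre C^2 *)
Definition spinor_class (q : Q Sp) (w : spinor_module)
    : set (Q Sp * @spinor_module R) :=
  [set p | exists a, Spin a /\ p = (act q a, invmx a *m w)].

(* f is the coordinate function of varphi in the trivialization sigma k *)
Definition spinor_coord (varphi : M -> set (Q Sp * @spinor_module R))
    (k : triv_index Sp) (f : M -> spinor_module) : Prop :=
  forall x, triv k x -> varphi x = spinor_class (sigma k x) (f x).

Definition spinor_field (varphi : M -> set (Q Sp * @spinor_module R)) : Prop :=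
  forall k, exists f, csmooth_on (triv k) f /\ spinor_coord varphi k f.

Definition sframe (k : triv_index Sp) (x : M) : frame := Lambda (sigma k x).

(* Coordinates in the trivialization sigma k of nabla^S_v [sigma k, f].  The
   second term is the action of the local connection form of the Levi-Civita
   connection in the frame (s_1, s_2) covered by sigma k, lifted to spin(1,1):
   1/2 sum_(i < j) eps_i eps_j g(nabla_v s_i, s_j) e_i e_j, with eps_1 = -1 and
   eps_2 = 1. *)
Definition nablaS (k : triv_index Sp) (v : components M)
    (f : M -> spinor_module) (x : M) : spinor_module :=
  cdirderiv f v x -
  (2^-1 * inner g x (nablaLC g v (fun z => (sframe k z).1) x)
                    (sframe k x).2)%:C%C *: (clomega *m f x).

Definition Dirac (k : triv_index Sp) (f : M -> spinor_module) (x : M)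
    : spinor_module :=
  - (cl1 *m nablaS k (sframe k x).1 f x) + cl2 *m nablaS k (sframe k x).2 f x.

(* Clifford multiplication by the tangent vector v, in the trivialization
   sigma k *)
Definition clifford_mul (k : triv_index Sp) (x : M) (v : components M)
    (w : spinor_module) : spinor_module :=
  clifford (\col_i (if i == 0 then - inner g x v (sframe k x).1
                    else inner g x v (sframe k x).2)) *m w.

Definition harmonic (varphi : M -> set (Q Sp * @spinor_module R)) : Prop :=
  forall k f, spinor_coord varphi k f ->
  forall x, triv k x -> Dirac k f x = 0.

Definition twistor (varphi : M -> set (Q Sp * @spinor_module R)) : Prop :=
  forall k f, spinor_coord varphi k f ->
  forall V, vector_field V -> forall x, triv k x ->
    nablaS k (V x) f x = - (2^-1 : R)%:C%C *: clifford_mul k x (V x) (Dirac k f x).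

Definition positive_spinor (varphi : M -> set (Q Sp * @spinor_module R)) : Prop :=
  forall x q w, varphi x (q, w) -> clomega *m w = - w.

Definition negative_spinor (varphi : M -> set (Q Sp * @spinor_module R)) : Prop :=
  forall x q w, varphi x (q, w) -> clomega *m w = w.

Definition without_zeros (varphi : M -> set (Q Sp * @spinor_module R)) : Prop :=
  forall x q w, varphi x (q, w) -> w <> 0.

End Spinors.

(* Main.v *)
Require Import Defs.
From mathcomp Require Import ring lra.
Set Implicit Arguments.
Unset Strict Implicit.
Unset Printing Implicit Defensive.
Import Order.TTheory GRing.Theory Num.Theory.
Import numFieldNormedType.Exports.
Local Open Scope classical_set_scope.
Local Open Scope ring_scope.

(** For a local oriented orthonormal frame [s] put [w(v) = g(nabla_v s_1, s_2)].
    Metric compatibility gives [nabla_v s_1 = w(v) s_2] and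
    [nabla_v s_2 = w(v) s_1], hence [nabla_v X_s = w(v) X_s] and
    [div X_s = w(X_s)]: (ii) and (iv) both say [w(X_s) = 0].  A nowhere vanishing
    X-field [X] is [X_s] for the frame built from [X] and the null field [Y] with
    [g(X, Y) = 2], which a timelike field provides explicitly.

    In the frame [s], [D (f, 0) = 0] reads [X_s f + w(X_s) f / 2 = 0], and the
    twistor equation for [(0, f)] reads [X_s f - w(X_s) f / 2 = 0].  If
    [w(X_s) = 0], constant spinors of the trivial spin structure are solutions.
    Conversely [|f|^2 X_s], resp. [X_s / |f|^2], is divergence free, and it does
    not depend on the trivialization up to sign, as Spin(1,1) consists of the
    matrices diag(a, b) with [a b = 1] or [a b = -1], which multiply [X_s] by
    [a / b]. *)

(** * Case analysis and sums over the two coordinate indices *)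

Lemma ord2P (P : 'I_2 -> Prop) : P 0 -> P 1 -> forall j, P j.
Proof.
move=> P0 P1 [[|[|//]] i].
  by rewrite (_ : Ordinal i = 0) //; apply: val_inj.
by rewrite (_ : Ordinal i = 1) //; apply: val_inj.
Qed.

Lemma sum2E {V : nmodType} (F : 'I_2 -> V) : \sum_(i < 2) F i = F 0 + F 1.
Proof. by rewrite big_ord_recl big_ord1; congr (_ + F _); exact: val_inj. Qed.

(** * Closure properties of C^k maps on open subsets of normed spaces *)

Section Calculus.
Context {R : realType} {V : normedModType R}.

(** The difference [h - f] vanishes near [x], hence is differentiable there with zero differential;
    adding it to [f] gives [h]. *)
Lemma near_eq_differentiable {W : normedModType R} (f h : V -> W) x :
  (\forall y \near x, f y = h y) -> differentiable f x -> differentiable h x.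
Proof.
move=> fh df; pose e := h - f.
suff de : differentiable e x.
  by rewrite (_ : h = e + f) ?funeqE => [|y]; [exact: differentiableD|rewrite /e !fctE subrK].
have e0 : \forall y \near x, e y = 0.
  by near=> y; rewrite /e !fctE (near fh y) ?subrr //; near: y.
have ex0 : e x = 0 by exact: nbhs_singleton e0.
have eo : e \o shift x = cst (e x) + (0 : V -> W) +o_ (0 : V) id.
  apply/eqaddoP => _/posnumP[eps]; near=> y.
  rewrite /= !fctE /= ex0 (_ : e (y + x) = 0).
    by rewrite (_ : (0 : V -> W) y = 0) // addr0 subr0 normr0 mulr_ge0.
  near: y; have := e0; rewrite (near_shift 0 x) /=.
  by apply: filterS => y /=; rewrite subr0.
have c0 : continuous (0 : V -> W) by move=> y; exact: cst_continuous.
have d0 : ('d e x : V -> W) = \0 by apply: (@diff_unique _ _ _ _ \0%R).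
by apply/diff_locallyP; rewrite d0; split.
Unshelve. all: by end_near. Qed.

Lemma derive_additive {W : normedModType R} (f : V -> W) x u v :
  differentiable f x -> 'D_(u + v) f x = 'D_u f x + 'D_v f x.
Proof. by move=> df; rewrite !deriveE // linearD. Qed.

Lemma derive_homogeneous {W : normedModType R} (f : V -> W) x (k : R) u :
  differentiable f x -> 'D_(k *: u) f x = k *: 'D_u f x.
Proof. by move=> df; rewrite !deriveE // linearZ. Qed.

(** Differentiability passes between maps that agree near a point. As [U'] is open, the derivatives
    of [f'] and [f] also agree on [U'], so the same neighbourhood serves at the next order. *)
Lemma Ck_on_local {W : normedModType R} k (U : set V) (f : V -> W) : open U ->
  (forall x, U x -> exists U' f', [/\ open U', U' x, Ck_on k U' f' &
     forall y, U' y -> f' y = f y]) -> Ck_on k U f.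
Proof.
elim: k U f => [|k IH] U f oU H.
  move=> x /H [U' [f' [oU' U'x cf' ff']]].
  have ef : \forall y \near x, f' y = f y by near=> y; apply: ff'; near: y; apply: open_nbhs_nbhs.
  move: (cf' _ U'x); rewrite /prop_for /continuous_at -(nbhs_singleton ef).
  by move=> /(cvg_trans _); apply; apply: near_eq_cvg.
split=> [x /H [U' [f' [oU' U'x [df' _] ff']]]|v].
  apply: near_eq_differentiable (df' _ U'x).
  by near=> y; apply: ff'; near: y; apply: open_nbhs_nbhs.
apply: IH => // x /H [U' [f' [oU' U'x [_ Df'] ff']]].
exists U', ('D_v f'); split=> //; first exact: Df'.
move=> y U'y; apply: near_eq_derive.
by near=> z; apply: ff'; near: z; apply: open_nbhs_nbhs.
Unshelve. all: by end_near. Qed.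

Lemma Ck_on_eq {W : normedModType R} k (U : set V) (f h : V -> W) : open U ->
  (forall y, U y -> f y = h y) -> Ck_on k U f -> Ck_on k U h.
Proof. by move=> oU fh kf; apply: Ck_on_local => // x Ux; exists U, f. Qed.

Lemma Ck_onS {W : normedModType R} k (U U' : set V) (f : V -> W) :
  U' `<=` U -> Ck_on k U f -> Ck_on k U' f.
Proof.
move=> sU; elim: k f => [|k IH] f; first by move=> cf x /sU /cf.
by case=> df Df; split=> [x /sU /df|v] //; exact/IH/Df.
Qed.

(** The Leibniz rule leaves one factor underived; this brings its order down to that of the derived
    factor. *)
Lemma Ck_onW {W : normedModType R} k (U : set V) (f : V -> W) :
  Ck_on k.+1 U f -> Ck_on k U f.
Proof.
elim: k f => [|k IH] f [df Df]; first by move=> x Ux; apply/differentiable_continuous/df.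
by split=> // v; apply: IH.
Qed.

Lemma Ck_on_cst {W : normedModType R} k (U : set V) (w : W) : open U -> Ck_on k U (cst w).
Proof.
move=> oU; elim: k w => [|k IH] w; first by move=> x _; exact: cst_continuous.
split=> [x _|v]; first exact: differentiable_cst.
by apply: Ck_on_eq (IH 0) => // y _; rewrite derive_cst.
Qed.

Lemma Ck_onD {W : normedModType R} k (U : set V) (f h : V -> W) : open U ->
  Ck_on k U f -> Ck_on k U h -> Ck_on k U (f + h).
Proof.
move=> oU; elim: k f h => [|k IH] f h.
  by move=> cf ch x Ux; apply: cvgD; [exact: cf|exact: ch].
move=> [df Df] [dh Dh]; split=> [x Ux|v]; first by apply: differentiableD; auto.
apply: Ck_on_eq (IH _ _ (Df v) (Dh v)) => // y Uy.
by rewrite deriveD //; apply: diff_derivable; auto.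
Qed.

Lemma Ck_onM k (U : set V) (f h : V -> R) : open U ->
  Ck_on k U f -> Ck_on k U h -> Ck_on k U (f * h).
Proof.
move=> oU; elim: k f h => [|k IH] f h.
  by move=> cf ch x Ux; apply: cvgM; [exact: cf|exact: ch].
move=> kf kh; move: (kf) (kh) => [df Df] [dh Dh].
split=> [x Ux|v]; first by apply: differentiableM; auto.
apply: Ck_on_eq (Ck_onD oU (IH _ _ (Ck_onW kf) (Dh v)) (IH _ _ (Ck_onW kh) (Df v))) => // y Uy.
by rewrite deriveM //; apply: diff_derivable; auto.
Qed.

(** The derivative of [1 / f] is [- f' * (1 / f)^2], and [1 / f] is already C^k by induction when
    [f] is C^(k+1). *)
Lemma Ck_onV k (U : set V) (f : V -> R) : open U -> (forall x, U x -> f x != 0) ->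
  Ck_on k U f -> Ck_on k U (fun x => (f x)^-1).
Proof.
move=> oU f0; elim: k => [|k IH].
  by move=> cf x Ux; apply: cvgV; [exact: f0|exact: cf].
move=> kf; move: (kf) => [df Df].
split=> [x Ux|v]; first by apply: differentiableV; auto.
have kV := IH (Ck_onW kf).
apply: Ck_on_eq (Ck_onM oU (Ck_onM oU (Ck_on_cst k (-1 : R) oU) (Df v))
                           (Ck_onM oU kV kV)) => // y Uy.
rewrite deriveV //; [|exact: f0|by apply: diff_derivable; auto].
by rewrite /= !fctE /GRing.scale /=; field; exact: f0.
Qed.

Lemma Ck_on_coord m n k (U : set V) (f : V -> 'M[R]_(m, n)) i j : open U ->
  Ck_on k U f -> Ck_on k U (fun x => f x i j).
Proof.
move=> oU; elim: k f => [|k IH] f.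
  move=> cf x Ux.
  apply: (@continuous_comp _ _ _ f (fun M : 'M[R]_(m, n) => M i j)); first exact: cf.
  exact: coord_continuous.
move=> [df Df]; split=> [x Ux|v].
  apply: (@differentiable_comp _ _ _ _ f (fun M : 'M[R]_(m, n) => M i j)).
    exact: df.
  exact: differentiable_coord.
apply: Ck_on_eq (IH _ (Df v)) => // y Uy.
by rewrite derive_mx ?mxE //; apply/diff_derivable/df.
Qed.

Lemma Ck_onZl {W : normedModType R} k (U : set V) (f : V -> R) (w : W) : open U ->
  Ck_on k U f -> Ck_on k U (fun x => f x *: w).
Proof.
move=> oU; elim: k f => [|k IH] f.
  by move=> cf x Ux; apply: cvgZr_tmp; exact: cf.
move=> [df Df]; split=> [x Ux|v]; first exact/differentiableZl/df.
apply: Ck_on_eq (IH _ (Df v)) => // y /df dfy.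
by rewrite !deriveE ?diffZl //; exact: differentiableZl.
Qed.

Lemma Ck_on_row2 k (U : set V) (f : V -> 'rV[R]_2) : open U ->
  (forall j, Ck_on k U (fun x => f x 0 j)) -> Ck_on k U f.
Proof.
move=> oU kf.
apply: Ck_on_eq (Ck_onD oU (Ck_onZl (basis_vec R 0) oU (kf 0))
                          (Ck_onZl (basis_vec R 1) oU (kf 1))) => // y _.
apply/rowP => j; rewrite !fctE !mxE /=.
by elim/ord2P: j => /=; ring.
Qed.

End Calculus.

(** * Charts, smooth functions and vector fields on the surface *)

Section SurfaceCalculus.
Context {R : realType} {M : surface R}.
Implicit Types (c : chart M) (U : set M) (x : M).

(** Turns an identity on an open set of [M] into one near [phi c x] in the plane, the form in which
    derivatives in a chart can be compared. *)
Lemma chart_near c x U : dom c x -> open U -> U x ->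
  \forall y \near phi c x,
    [/\ dom c (psi c y), U (psi c y) & phi c (psi c y) = y].
Proof.
move=> cx oU Ux.
have : \forall y \near phi c x, (phi c @` dom c) y.
  by apply: open_nbhs_nbhs; split; [exact: phi_open|exists x].
have : \forall y \near phi c x, U (psi c y).
  have := @psi_continuous _ _ c (phi c x) (ex_intro2 _ _ x cx erefl).
  by apply; rewrite phiK //; apply: open_nbhs_nbhs.
by apply: filterS2 => y Uy [z cz zy]; rewrite -zy phiK // in Uy *.
Qed.

Lemma open_chart_image c U : open U -> open (phi c @` (dom c `&` U)).
Proof.
move=> oU; rewrite openE => _ [x [cx Ux] <-].
apply: filterS (chart_near cx oU Ux) => y [cy Uy yy].
by exists (psi c y).
Qed.

Lemma chart_imageP c U y : (phi c @` (dom c `&` U)) y ->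
  [/\ dom c (psi c y), U (psi c y) & phi c (psi c y) = y].
Proof. by case=> x [cx Ux] <-; rewrite phiK. Qed.

Lemma near_chart_eq {W : Type} c x U (f h : M -> W) : dom c x -> open U -> U x ->
  (forall z, U z -> f z = h z) ->
  \forall y \near phi c x, f (psi c y) = h (psi c y).
Proof. by move=> cx oU Ux fh; apply: filterS (chart_near cx oU Ux) => y [_ /fh]. Qed.

Section SmoothFunctions.
Variables (U : set M) (oU : open U).

Lemma smooth_fun_on_cst {W : normedModType R} (w : W) : smooth_fun_on U (cst w).
Proof. by move=> c k; apply: Ck_on_cst; exact: open_chart_image. Qed.

Lemma smooth_fun_onD (f h : M -> R) : smooth_fun_on U f -> smooth_fun_on U h ->
  smooth_fun_on U (fun x => f x + h x).
Proof. by move=> sf sh c k; apply: Ck_onD; [exact: open_chart_image|exact: sf|exact: sh]. Qed.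

Lemma smooth_fun_onM (f h : M -> R) : smooth_fun_on U f -> smooth_fun_on U h ->
  smooth_fun_on U (fun x => f x * h x).
Proof. by move=> sf sh c k; apply: Ck_onM; [exact: open_chart_image|exact: sf|exact: sh]. Qed.

Lemma smooth_fun_onV (f : M -> R) : (forall x, U x -> f x != 0) ->
  smooth_fun_on U f -> smooth_fun_on U (fun x => (f x)^-1).
Proof.
move=> f0 sf c k; apply: Ck_onV; [exact: open_chart_image| |exact: sf].
by move=> y /chart_imageP [_ Uy _]; exact: f0.
Qed.

End SmoothFunctions.

Lemma smooth_fun_on_differentiable U c x (f : M -> R) :
  smooth_fun_on U f -> dom c x -> U x -> differentiable (f \o psi c) (phi c x).
Proof. by move=> sf cx Ux; apply: (sf c 1%N).1; exists x. Qed.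

Lemma dtransitionD c d x u v : dom c x -> dom d x ->
  dtransition c d x (u + v) = dtransition c d x u + dtransition c d x v.
Proof.
move=> cx dx; apply: derive_additive.
by apply: (transition_smooth c d 1%N).1; exists x.
Qed.

Lemma dtransitionZ c d x (k : R) u : dom c x -> dom d x ->
  dtransition c d x (k *: u) = k *: dtransition c d x u.
Proof.
move=> cx dx; apply: derive_homogeneous.
by apply: (transition_smooth c d 1%N).1; exists x.
Qed.

Lemma dtransition_id c x u : dom c x -> dtransition c c x u = u.
Proof.
move=> cx; rewrite /dtransition (@near_eq_derive _ _ _ _ id) ?derive_id //.
by apply: filterS (chart_near cx openT I) => y [].
Qed.

Lemma tangent_comb x (a b : R) v w : tangent x v -> tangent x w ->
  tangent x (a *: v + b *: w).
Proof.
move=> [tv v0] [tw w0]; split=> [c d cx dx|c ncx]; rewrite !fctE.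
  by rewrite dtransitionD // !dtransitionZ // -tv // -tw.
by rewrite v0 // w0 // !scaler0 addr0.
Qed.

(** The transition rule recovers the components in every chart around [x] from those in
    [chart_at x]; the other charts carry 0. *)
Lemma tangent_eq x v w : tangent x v -> tangent x w ->
  v (chart_at x) = w (chart_at x) -> v = w.
Proof.
move=> [tv v0] [tw w0] vw; apply/funext => c.
have [cx|ncx] := pselect (dom c x); last by rewrite v0 // w0.
by rewrite (tv (chart_at x) c) ?(tw (chart_at x) c) ?vw //; exact: dom_chart_at.
Qed.

Lemma vector_field_on_coord U V c j : open U -> vector_field_on U V ->
  smooth_on (phi c @` (dom c `&` U)) (fun y => V (psi c y) c 0 j).
Proof. by move=> oU [_ sV] k; apply: Ck_on_coord; [exact: open_chart_image|exact: sV]. Qed.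

Lemma vector_field_on_comb U (a b : M -> R) V W : open U ->
  smooth_fun_on U a -> smooth_fun_on U b ->
  vector_field_on U V -> vector_field_on U W ->
  vector_field_on U (fun x => a x *: V x + b x *: W x).
Proof.
move=> oU sa sb vV vW; split=> [x Ux|c k].
  by apply: tangent_comb; [exact: vV.1|exact: vW.1].
have oI := open_chart_image (c := c) oU.
apply: Ck_on_row2 => // j.
apply: Ck_on_eq (Ck_onD oI (Ck_onM oI (sa c k) (vector_field_on_coord c j oU vV k))
  (Ck_onM oI (sb c k) (vector_field_on_coord c j oU vW k))) => // y _.
by rewrite !fctE !mxE.
Qed.

(** Serves for fields whose formula depends on a choice made around each point. *)
Lemma vector_field_on_local V (U : M -> set M) (W : M -> M -> components M) :
  (forall x, open (U x)) -> (forall x, U x x) ->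
  (forall x, vector_field_on (U x) (W x)) ->
  (forall x y, U x y -> V y = W x y) -> vector_field V.
Proof.
move=> oU Ux vW VW; split=> [x _|c k].
  by rewrite (VW x) //; apply: (vW x).1.
apply: Ck_on_local; first exact/open_chart_image/openT.
move=> y /chart_imageP [cy _ yy].
set x := psi c y in cy yy.
exists (phi c @` (dom c `&` U x)), (fun y => W x (psi c y) c); split.
- exact: open_chart_image.
- by exists x.
- exact: (vW x).2.
- by move=> z /chart_imageP [_ Uz _]; rewrite -(VW x).
Qed.

Lemma chart_imageS c U U' : U' `<=` U ->
  (phi c @` (dom c `&` U')) `<=` (phi c @` (dom c `&` U)).
Proof. by move=> sU _ [x [cx /sU Ux] <-]; exists x. Qed.

Lemma vector_field_onS U U' (V : M -> components M) : U' `<=` U ->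
  vector_field_on U V -> vector_field_on U' V.
Proof.
move=> sU [tV sV]; split=> [x /sU /tV //|c k].
by apply: Ck_onS (sV c k); exact: chart_imageS.
Qed.

Lemma smooth_fun_on_continuous {W : normedModType R} U (f : M -> W) x :
  open U -> U x -> smooth_fun_on U f -> {for x, continuous f}.
Proof.
move=> oU Ux sf; have cx := dom_chart_at x; set c := chart_at x in cx.
have cf : {for phi c x, continuous (f \o psi c)}.
  by apply: (sf c 0%N); exists x.
have := @continuous_comp _ _ _ (phi c) (f \o psi c) x (phi_continuous cx) cf.
rewrite /prop_for /continuous_at /= phiK // => /(cvg_trans _); apply.
apply: near_eq_cvg; have : nbhs x (dom c) by apply: open_nbhs_nbhs; split => //; exact: dom_open.
by apply: filterS => z cz; rewrite /= phiK.
Qed.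

Lemma vector_field_on_scale U (a : M -> R) V : open U ->
  smooth_fun_on U a -> vector_field_on U V -> vector_field_on U (fun x => a x *: V x).
Proof.
move=> oU sa vV.
rewrite (_ : (fun x => _) = fun x => a x *: V x + (cst 0 x : R) *: V x).
  by apply: vector_field_on_comb => //; exact: smooth_fun_on_cst.
by apply/funext => x; rewrite /= scale0r addr0.
Qed.

End SurfaceCalculus.

(** * Bilinear forms on the plane given by a Gram matrix *)

Definition bform {R : realType} (G : 'M[R]_2) (v w : 'rV[R]_2) : R :=
  (v *m G *m w^T) 0 0.

Lemma bformE {R : realType} (G : 'M[R]_2) v w :
  bform G v w = v 0 0 * G 0 0 * w 0 0 + v 0 1 * G 1 0 * w 0 0 +
                (v 0 0 * G 0 1 * w 0 1 + v 0 1 * G 1 1 * w 0 1).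
Proof. by rewrite /bform !mxE !sum2E !mxE !sum2E; ring. Qed.

Section BilinearForm.
Context {R : realType} (G : 'M[R]_2).
Implicit Types u v w : 'rV[R]_2.

Lemma bformC v w : G^T = G -> bform G v w = bform G w v.
Proof. by move=> /matrixP/(_ 0 1); rewrite mxE !bformE => ->; ring. Qed.

Lemma bformDl u v w : bform G (u + v) w = bform G u w + bform G v w.
Proof. by rewrite /bform !mulmxDl mxE. Qed.

Lemma bformZl (k : R) v w : bform G (k *: v) w = k * bform G v w.
Proof. by rewrite /bform -!scalemxAl mxE. Qed.

(** If [S] has rows [s1], [s2] and [N = diag(-1, 1)], orthonormality says [S G S^T = N], so
    [G S^T N] is a right inverse of [S]. For square matrices it is also a left inverse:
    [G S^T N S = 1] shows that [G] is invertible and, multiplied by [u], gives the expansion. *)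
Lemma orthonormal_expansion s1 s2 : G^T = G ->
    bform G s1 s1 = -1 -> bform G s2 s2 = 1 -> bform G s1 s2 = 0 ->
  G \in unitmx /\ forall u, u = - bform G u s1 *: s1 + bform G u s2 *: s2.
Proof.
move=> sG s11 s22 s12; have s21 : bform G s2 s1 = 0 by rewrite bformC.
pose S : 'M[R]_2 := \matrix_(i < 2) (if i == 0 then s1 else s2).
pose N : 'M[R]_2 := \matrix_(i < 2, j < 2) (if i != j then 0 else if i == 0 then -1 else 1).
have SN : S *m (G *m S^T *m N) = 1%:M.
  apply/matrixP => i j; move: s11 s22 s12 s21; rewrite !bformE => s11 s22 s12 s21.
  rewrite !(mxE, sum2E).
  by elim/ord2P: i; elim/ord2P: j => /=; lra.
have NS : G *m (S^T *m N *m S) = 1%:M by move/mulmx1C: SN; rewrite !mulmxA.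
split=> [|u]; first by case/mulmx1_unit: NS.
rewrite -[LHS]mulmx1 -NS; apply/rowP => j.
by rewrite !bformE !(mxE, sum2E) /=; ring.
Qed.

End BilinearForm.

(** * The Lorentzian inner product, orientation and orthonormal expansions *)

Section LorentzAlgebra.
Context {R : realType} {M : surface R} (g : lorentz_metric M).
Implicit Types (x : M) (u v w : components M).

(** [inner] is evaluated in [chart_at x], which may jump with [x]; differentiating it along the
    surface requires one fixed chart. *)
Lemma inner_chart c x v w : dom c x -> tangent x v -> tangent x w ->
  inner g x v w = bform (g x c) (v c) (w c).
Proof.
move=> cx [tv _] [tw _]; have kx := dom_chart_at x.
by rewrite /inner /bform (gram_transition g kx cx) -tv // -tw.
Qed.

Lemma innerC x v w : inner g x v w = inner g x w v.
Proof. by apply: bformC; exact/gram_sym/dom_chart_at. Qed.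

Lemma innerDl x u v w : inner g x (u + v) w = inner g x u w + inner g x v w.
Proof. exact: bformDl. Qed.

Lemma innerZl x (k : R) v w : inner g x (k *: v) w = k * inner g x v w.
Proof. exact: bformZl. Qed.

Lemma innerDr x u v w : inner g x u (v + w) = inner g x u v + inner g x u w.
Proof. by rewrite !(innerC x u) innerDl. Qed.

Lemma innerZr x (k : R) v w : inner g x v (k *: w) = k * inner g x v w.
Proof. by rewrite !(innerC x v) innerZl. Qed.

Lemma inner_smooth U V W : open U -> vector_field_on U V -> vector_field_on U W ->
  smooth_fun_on U (fun x => inner g x (V x) (W x)).
Proof.
move=> oU vV vW c k; have oI := open_chart_image (c := c) oU.
pose G a b y := g (psi c y) c a b.
have sG a b : Ck_on k (phi c @` (dom c `&` U)) (G a b).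
  apply: Ck_on_local => // y /chart_imageP [cy Uy yy].
  exists (phi c @` dom c), (G a b); split=> //; first exact: phi_open.
    by exists (psi c y).
  exact: gram_smooth.
have sV j := vector_field_on_coord c j oU vV k.
have sW j := vector_field_on_coord c j oU vW k.
have sT a b := Ck_onM oI (Ck_onM oI (sV a) (sG a b)) (sW b).
apply: Ck_on_eq (Ck_onD oI (Ck_onD oI (sT 0 0) (sT 1 0)) (Ck_onD oI (sT 0 1) (sT 1 1))) => //.
move=> y /chart_imageP [cy Uy _].
by rewrite /= (inner_chart cy) ?bformE //; [exact: vV.1|exact: vW.1].
Qed.

Definition area x v w : R :=
  v (chart_at x) 0 0 * w (chart_at x) 0 1 - v (chart_at x) 0 1 * w (chart_at x) 0 0.

Lemma positively_orientedE x v w : positively_oriented x v w = (0 < area x v w) :> Prop.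
Proof.
rewrite /positively_oriented (expand_det_row _ 0) sum2E /cofactor !det_mx11 !mxE /=.
rewrite /area; congr (is_true (_ < _)); rewrite (_ : lift 0 0 = 1); last exact: val_inj.
by rewrite (_ : lift 1 0 = 0) ?expr0 ?expr1 /=; [ring|exact: val_inj].
Qed.

Lemma area_comb x (a b p q : R) v w :
  area x (a *: v + b *: w) (p *: v + q *: w) = (a * q - b * p) * area x v w.
Proof. by rewrite /area !fctE !mxE; ring. Qed.

Definition orthonormal x v w : Prop :=
  [/\ inner g x v v = -1, inner g x w w = 1 & inner g x v w = 0].

Lemma gram_unit x : g x (chart_at x) \in unitmx.
Proof.
have [v [w [tv tw vv ww vw]]] := gram_signature g x.
by have [] := orthonormal_expansion (gram_sym g (dom_chart_at x)) vv ww vw.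
Qed.

Lemma frame_expansion x v w u : tangent x v -> tangent x w -> tangent x u ->
  orthonormal x v w -> u = - inner g x u v *: v + inner g x u w *: w.
Proof.
move=> tv tw tu [vv ww vw].
have [_ E] := orthonormal_expansion (gram_sym g (dom_chart_at x)) vv ww vw.
by apply: (tangent_eq tu); [exact: tangent_comb|exact: E].
Qed.

(** In an orthonormal basis, [v = a e + b f] with [a^2 = b^2], and [w = p e + q f] with [p^2 > q^2].
    Orthogonality [a p = b q] gives [a^2 (p^2 - q^2) = 0], so [a] and then [b] vanish. *)
Lemma lightlike_timelike x v w : tangent x v -> tangent x w ->
  lightlike g x v -> timelike g x w -> inner g x v w != 0.
Proof.
move=> tv tw [v0 vv]; rewrite /timelike => ww; apply/eqP => vw.
have [e [f [te tf ee ff ef]]] := gram_signature g x.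
have o : orthonormal x e f by [].
have Ev := frame_expansion te tf tv o; have Ew := frame_expansion te tf tw o.
set a := - inner g x v e in Ev; set b := inner g x v f in Ev.
set p := - inner g x w e in Ew; set q := inner g x w f in Ew.
have fe : inner g x f e = 0 by rewrite innerC.
move: vv vw ww; rewrite Ev Ew !(innerDl, innerDr, innerZl, innerZr) ee ff ef fe => vv vw ww.
have ab : a ^+ 2 = b ^+ 2 by lra.
have : a ^+ 2 * (p ^+ 2 - q ^+ 2) = 0.
  have -> : a ^+ 2 * (p ^+ 2 - q ^+ 2) = (a * p) ^+ 2 - b ^+ 2 * q ^+ 2 by rewrite -ab; ring.
  by rewrite (_ : a * p = b * q); [ring|lra].
move/eqP; rewrite mulf_eq0 => /orP[|/eqP]; last by lra.
rewrite sqrf_eq0 => /eqP a0; apply: v0; rewrite Ev a0 scale0r add0r.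
suff -> : b = 0 by rewrite scale0r.
by apply/eqP; rewrite -sqrf_eq0 -ab a0 expr0n.
Qed.

(** The two products are the coordinates of [u] up to sign; if they were equal,
    [g(u, u) = - p^2 + q^2] would be 0. The difference is g(u, Y_s) for the frame [(v, w)]. *)
Lemma timelike_inner_neq x v w u : tangent x v -> tangent x w -> tangent x u ->
  orthonormal x v w -> timelike g x u -> inner g x u w - inner g x u v != 0.
Proof.
move=> tv tw tu o; rewrite /timelike.
rewrite [X in inner _ _ X _](frame_expansion tv tw tu o) innerDl !innerZl.
rewrite (innerC x v) (innerC x w); move: (inner g x u v) (inner g x u w) => p q pq.
apply/eqP => E; have e : q = p by lra.
by move: pq; rewrite e; lra.
Qed.

End LorentzAlgebra.

(** * The Levi-Civita connection in coordinates: metric compatibility and divergence *)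

Lemma row2_basis {R : realType} (u : 'rV[R]_2) :
  u = u 0 0 *: basis_vec R 0 + u 0 1 *: basis_vec R 1.
Proof. by apply/rowP => j; rewrite !mxE /=; elim/ord2P: j => /=; ring. Qed.

Section LeviCivita.
Context {R : realType} {M : surface R} (g : lorentz_metric M).
Implicit Types (x : M) (c : chart M) (V W : M -> components M).

Lemma gram_differentiable c x a b : dom c x ->
  differentiable (fun y => g (psi c y) c a b) (phi c x).
Proof. by move=> cx; apply: (gram_smooth g c a b 1%N).1; exists x. Qed.

Lemma field_differentiable U c x V j : open U -> U x -> dom c x ->
  vector_field_on U V -> differentiable (fun y => V (psi c y) c 0 j) (phi c x).
Proof.
by move=> oU Ux cx vV; apply: (vector_field_on_coord c j oU vV 1%N).1; exists x.
Qed.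

Lemma dgram_sym c x a b d : dom c x -> dgram g c x a b d = dgram g c x a d b.
Proof.
move=> cx; apply: near_eq_derive.
apply: filterS (chart_near cx openT I) => y [cy _ _].
by rewrite -[in LHS](gram_sym g cy) mxE.
Qed.

(** Lowering the index by the Gram matrix cancels the inverse matrix in [christoffel]. *)
Lemma christoffel_lower x f a b : let c := chart_at x in
  \sum_(e < 2) g x c f e * christoffel g c x e a b =
  2^-1 * (dgram g c x a b f + dgram g c x b a f - dgram g c x f a b).
Proof.
move=> c.
pose K d := dgram g c x a b d + dgram g c x b a d - dgram g c x d a b.
have E : g x c *m (invmx (g x c) *m \col_d K d) = \col_d K d.
  by rewrite mulmxA mulmxV ?gram_unit // mul1mx.
move/matrixP/(_ f 0): E; rewrite [RHS]mxE -/(K f) => <-.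
rewrite mxE mulr_sumr; apply: eq_bigr => e _; rewrite /christoffel !mxE mulrCA.
by congr (_ * (_ * _)); apply: eq_bigr => d _; rewrite mxE.
Qed.

(** In the sum of the two lowered Christoffel symbols every term cancels by symmetry of [g], except
    two halves of the left-hand side: the metric is parallel. *)
Lemma dgramE x a b d : let c := chart_at x in
  dgram g c x a b d = \sum_(e < 2) g x c d e * christoffel g c x e a b +
                      \sum_(e < 2) g x c b e * christoffel g c x e a d.
Proof.
move=> c; have cx : dom c x := dom_chart_at x.
rewrite !christoffel_lower -/c (dgram_sym a d b) // (dgram_sym d a b) //.
by rewrite (dgram_sym b a d) //; lra.
Qed.

Lemma derive_triple {V : normedModType R} (f h k : V -> R) (p u : V) :
  differentiable f p -> differentiable h p -> differentiable k p ->
  'D_u (fun y => f y * h y * k y) p =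
  'D_u f p * h p * k p + f p * 'D_u h p * k p + f p * h p * 'D_u k p.
Proof.
move=> df dh dk.
have -> : (fun y => f y * h y * k y) = f * h * k by apply/funext.
rewrite !deriveM //; try exact: diff_derivable.
  by rewrite !fctE /GRing.scale /=; ring.
by apply: diff_derivable; exact: differentiableM.
Qed.

Lemma differentiable_triple {V : normedModType R} (f h k : V -> R) (p : V) :
  differentiable f p -> differentiable h p -> differentiable k p ->
  differentiable (fun y => f y * h y * k y) p.
Proof.
move=> df dh dk.
have -> : (fun y => f y * h y * k y) = f * h * k by apply/funext.
by apply: differentiableM => //; exact: differentiableM.
Qed.

Lemma derive_sum4 {V : normedModType R} (a b d e : V -> R) (p u : V) :
  differentiable a p -> differentiable b p -> differentiable d p -> differentiable e p ->
  'D_u (fun y => a y + b y + (d y + e y)) p =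
  'D_u a p + 'D_u b p + ('D_u d p + 'D_u e p).
Proof.
move=> da db dd de.
have -> : (fun y => a y + b y + (d y + e y)) = (a + b) + (d + e) by apply/funext.
have dab := differentiableD da db; have dde := differentiableD dd de.
by rewrite !deriveD //; exact: diff_derivable.
Qed.

(** The product rule on the four terms of [bformE], with [dgramE] for the derivatives of the Gram
    matrix, regroups into the two covariant derivatives. *)
Lemma metric_compatible U x V W u : let c := chart_at x in
  open U -> U x -> vector_field_on U V -> vector_field_on U W ->
  'D_u (fun y => bform (g (psi c y) c) (V (psi c y) c) (W (psi c y) c)) (phi c x) =
  bform (g x c) (cov g c u V x) (W x c) + bform (g x c) (V x c) (cov g c u W x).
Proof.
move=> c oU Ux vV vW; have cx : dom c x := dom_chart_at x.
have dV j := field_differentiable j oU Ux cx vV.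
have dW j := field_differentiable j oU Ux cx vW.
have dG a b := gram_differentiable a b cx.
have DG a b : 'D_u (fun y => g (psi c y) c a b) (phi c x) =
    u 0 0 * dgram g c x 0 a b + u 0 1 * dgram g c x 1 a b.
  by rewrite {1}(row2_basis u) derive_additive // !derive_homogeneous.
have dT a b := differentiable_triple (dV a) (dG a b) (dW b).
under eq_fun do rewrite bformE.
rewrite derive_sum4 // !derive_triple // !DG !dgramE -/c phiK // !bformE /cov.
(* The derivatives of the components become opaque reals, so that a polynomial identity remains. *)
have [dv EV] : exists dv : 'I_2 -> R, forall j,
  'D_u (fun y => V (psi c y) c 0 j) (phi c x) = dv j by eexists.
have [dw EW] : exists dw : 'I_2 -> R, forall j,
  'D_u (fun y => W (psi c y) c 0 j) (phi c x) = dw j by eexists.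
have /matrixP/(_ 0 1) := gram_sym g cx; rewrite mxE !mxE !EV !EW.
move: (christoffel g c x) (g x c) (V x c) (W x c) => Gam G v w sym.
by rewrite !sum2E sym; ring.
Qed.

Lemma cov_near U c x u V W : dom c x -> open U -> U x -> (forall z, U z -> V z = W z) ->
  cov g c u V x = cov g c u W x.
Proof.
move=> cx oU Ux VW; apply/rowP => e; rewrite !mxE VW //; congr (_ + _).
apply: near_eq_derive; have := near_chart_eq cx oU Ux VW.
by apply: filterS => y ->.
Qed.

Lemma divergence_near U x V W : open U -> U x -> (forall z, U z -> V z = W z) ->
  divergence g V x = divergence g W x.
Proof.
move=> oU Ux VW; apply: eq_bigr => a _.
by rewrite (cov_near _ (dom_chart_at x) oU Ux VW).
Qed.

Lemma cov_comb U c x (k l : R) u v V : dom c x -> open U -> U x -> vector_field_on U V ->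
  cov g c (k *: u + l *: v) V x = k *: cov g c u V x + l *: cov g c v V x.
Proof.
move=> cx oU Ux vV; apply/rowP => e; rewrite !(mxE, sum2E).
have dV := field_differentiable e oU Ux cx vV.
rewrite derive_additive // !derive_homogeneous // /GRing.scale /=; ring.
Qed.

Lemma cov_addfield U c x u V W : dom c x -> open U -> U x ->
  vector_field_on U V -> vector_field_on U W ->
  cov g c u (fun z => V z + W z) x = cov g c u V x + cov g c u W x.
Proof.
move=> cx oU Ux vV vW; apply/rowP => e; rewrite !(mxE, sum2E).
have dV := field_differentiable e oU Ux cx vV.
have dW := field_differentiable e oU Ux cx vW.
have -> : (fun y => (V (psi c y) + W (psi c y)) c 0 e) =
    (fun y => V (psi c y) c 0 e) + (fun y => W (psi c y) c 0 e).
  by apply/funext => y; rewrite !fctE !mxE.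
rewrite deriveD; [ring|exact: diff_derivable|exact: diff_derivable].
Qed.

Lemma cov_scalefield U c x u (h : M -> R) V : dom c x -> open U -> U x ->
  smooth_fun_on U h -> vector_field_on U V ->
  cov g c u (fun z => h z *: V z) x =
  'D_u (h \o psi c) (phi c x) *: V x c + h x *: cov g c u V x.
Proof.
move=> cx oU Ux sh vV; apply/rowP => e; rewrite !(mxE, sum2E).
have dV := field_differentiable e oU Ux cx vV.
have dh := smooth_fun_on_differentiable sh cx Ux.
have -> : (fun y => (h (psi c y) *: V (psi c y)) c 0 e) =
    (h \o psi c) * (fun y => V (psi c y) c 0 e).
  by apply/funext => y; rewrite !fctE !mxE.
rewrite deriveM ?phiK //; try exact: diff_derivable.
rewrite /= phiK // /GRing.scale /=; ring.
Qed.

(** The covariant derivative of [h V] gains the rank-one term dh tensor V, whose trace is dh(V). *)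
Lemma divergence_scale U x (h : M -> R) V : open U -> U x ->
  smooth_fun_on U h -> vector_field_on U V ->
  divergence g (fun z => h z *: V z) x =
  dirderiv h (V x) x + h x * divergence g V x.
Proof.
move=> oU Ux sh vV; have cx := dom_chart_at x.
have dh := smooth_fun_on_differentiable sh cx Ux.
rewrite /divergence /dirderiv !sum2E (row2_basis (V x (chart_at x))).
rewrite !(cov_scalefield _ cx oU Ux) // derive_additive // !derive_homogeneous //.
rewrite [X in X + _ = _]mxE [X in _ + X = _]mxE [X in X + _ + _ = _]mxE.
rewrite [X in _ + X + _ = _]mxE [X in _ + (X + _) = _]mxE [X in _ + (_ + X) = _]mxE.
rewrite /GRing.scale /=; ring.
Qed.

Lemma nablaLC_chart v V x :
  nablaLC g v V x (chart_at x) = cov g (chart_at x) (v (chart_at x)) V x.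
Proof.
have cx := dom_chart_at x; rewrite /nablaLC /of_components asboolT //.
exact: dtransition_id.
Qed.

Lemma nablaLC_eq0 v V x :
  cov g (chart_at x) (v (chart_at x)) V x = 0 -> nablaLC g v V x = 0.
Proof.
move=> E; apply/funext => c; rewrite /nablaLC /of_components E.
by case: ifP => // _; rewrite /dtransition derive0.
Qed.

End LeviCivita.

(** * The connection form of an orthonormal frame and the null field X_s *)

Section Frames.
Context {R : realType} {M : surface R} (g : lorentz_metric M).
Implicit Types (x : M) (U : set M) (s : M -> @frame R M).

(* the Levi-Civita connection form of the frame s, determined by
   nabla s_1 = (connection_form s) s_2 and nabla s_2 = (connection_form s) s_1 *)
Definition connection_form s (v : components M) x : R :=
  inner g x (nablaLC g v (fun z => (s z).1) x) (s x).2.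

Lemma connection_formE s v x : let c := chart_at x in
  connection_form s v x =
  bform (g x c) (cov g c (v c) (fun z => (s z).1) x) ((s x).2 c).
Proof. by rewrite /connection_form /inner nablaLC_chart. Qed.

Section LocalFrame.
Variables (U : set M) (s : M -> @frame R M).
Hypotheses (oU : open U) (hs : frame_section_on g U s).

Let s1 := fun z => (s z).1.
Let s2 := fun z => (s z).2.

Lemma frame_orthonormal x : U x -> orthonormal g x (s x).1 (s x).2.
Proof. by case: hs => /(_ x) h _ _ /h []. Qed.

Lemma frame_tangent x : U x -> tangent x (s x).1 /\ tangent x (s x).2.
Proof. by case: hs => /(_ x) h _ _ /h [[]]. Qed.

Lemma connection_form_comb x (k l : R) v w : U x ->
  connection_form s (k *: v + l *: w) x =
  k * connection_form s v x + l * connection_form s w x.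
Proof.
case: hs => _ h1 _ Ux; rewrite !connection_formE fctE.
by rewrite (cov_comb g _ _ _ _ (dom_chart_at x) oU Ux h1) bformDl !bformZl.
Qed.

Lemma cov_inner_cst (V W : M -> components M) (k : R) x u : let c := chart_at x in
  U x -> vector_field_on U V -> vector_field_on U W ->
  (forall z, U z -> inner g z (V z) (W z) = k) ->
  bform (g x c) (cov g c u V x) (W x c) + bform (g x c) (V x c) (cov g c u W x) = 0.
Proof.
move=> c Ux vV vW VWk; have cx : dom c x := dom_chart_at x.
rewrite -(metric_compatible _ _ oU Ux vV vW) -/c.
rewrite (@near_eq_derive _ _ _ _ (cst k)) ?derive_cst //.
apply: filterS (chart_near cx oU Ux) => y [cy Uy _].
by rewrite -inner_chart ?VWk //; [exact: vV.1|exact: vW.1].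
Qed.

(** Differentiating the three constant inner products gives g(nabla s_1, s_1) = 0, g(nabla s_2, s_2)
    = 0 and g(nabla s_2, s_1) = - w. In the orthonormal expansion the coefficient of s_1 carries a
    minus sign, which makes it + w. *)
Lemma cov_frame x v : U x -> let c := chart_at x in
  cov g c (v c) s1 x = connection_form s v x *: (s x).2 c /\
  cov g c (v c) s2 x = connection_form s v x *: (s x).1 c.
Proof.
move=> Ux c; have [_ h1 h2] := hs; have cx : dom c x := dom_chart_at x.
have sG : (g x c)^T = g x c by exact: gram_sym.
have [n1 n2 n12] := frame_orthonormal Ux.
have [_ E] := orthonormal_expansion sG n1 n2 n12.
have i11 z : U z -> inner g z (s1 z) (s1 z) = -1 by move/frame_orthonormal => [].
have i22 z : U z -> inner g z (s2 z) (s2 z) = 1 by move/frame_orthonormal => [].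
have i12 z : U z -> inner g z (s1 z) (s2 z) = 0 by move/frame_orthonormal => [].
have := cov_inner_cst (v c) Ux h1 h1 i11; have := cov_inner_cst (v c) Ux h2 h2 i22.
have := cov_inner_cst (v c) Ux h1 h2 i12.
rewrite -/c !(bformC _ (cov _ _ _ _ _) sG) -/s1 -/s2 => e12 e22 e11.
rewrite connection_formE -/c -/s1; split.
  by rewrite [LHS]E (_ : bform _ _ (s1 x c) = 0) ?oppr0 ?scale0r ?add0r //; lra.
rewrite [LHS]E (_ : bform _ _ (s2 x c) = 0) ?scale0r ?addr0; last by lra.
by congr (_ *: _); lra.
Qed.

Lemma Xof_field : vector_field_on U (Xof s).
Proof.
have [_ h1 h2] := hs.
rewrite (_ : Xof s = fun z => (cst (1 : R) z) *: (s z).1 + (cst (1 : R) z) *: (s z).2).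
  by apply: vector_field_on_comb => //; exact: smooth_fun_on_cst.
by apply/funext => z; rewrite /= !scale1r.
Qed.

(** The endomorphism nabla X_s is w tensor X_s, of rank one, with trace w(X_s). *)
Lemma divergence_Xof x : U x -> divergence g (Xof s) x = connection_form s (Xof s x) x.
Proof.
move=> Ux; have cx := dom_chart_at x; have [_ h1 h2] := hs.
(* [connection_form] takes a tangent vector, so the coordinate vector is extended to all charts by
   [of_components], which leaves it unchanged in its own chart. *)
have covX (a : 'I_2) : cov g (chart_at x) (basis_vec R a) (Xof s) x =
    connection_form s (of_components (chart_at x) x (basis_vec R a)) x *: Xof s x (chart_at x).
  rewrite /Xof (cov_addfield g _ cx oU Ux h1 h2).
  have [] := cov_frame (of_components (chart_at x) x (basis_vec R a)) Ux.
  rewrite /of_components asboolT // dtransition_id // => -> ->.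
  by rewrite fctE scalerDr addrC.
rewrite /divergence sum2E !covX [X in X + _ = _]mxE [X in _ + X = _]mxE !connection_formE.
rewrite /of_components asboolT // !dtransition_id //.
set k := Xof s x (chart_at x); rewrite (row2_basis k) (cov_comb g _ _ _ _ cx oU Ux h1).
by rewrite bformDl !bformZl; congr (_ + _); rewrite mulrC -row2_basis.
Qed.

Lemma nablaLC_frame_eq0 x v : U x -> connection_form s v x = 0 ->
  nablaLC g v s1 x = 0 /\ nablaLC g v s2 x = 0.
Proof.
move=> Ux w0; have [e1 e2] := cov_frame v Ux.
by split; apply: nablaLC_eq0; rewrite ?e1 ?e2 w0 scale0r.
Qed.

Lemma Xof_lightlike x : U x -> lightlike g x (Xof s x).
Proof.
move=> Ux; have [n1 n2 n12] := frame_orthonormal Ux.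
have n21 : inner g x (s x).2 (s x).1 = 0 by rewrite innerC.
split=> [/(congr1 (inner g x (s x).1))|].
  rewrite innerDr n1 n12 -(scale0r (s x).1) innerZr; lra.
by rewrite innerDl !innerDr n1 n2 n12 n21; lra.
Qed.

(* The null partner in the definition of the distribution is k Y_s. *)
Lemma Xof_Xdistribution x (k : R) : U x -> k != 0 -> Xdistribution g x (k *: Xof s x).
Proof.
move=> Ux k0; have [n1 n2 n12] := frame_orthonormal Ux.
have n21 : inner g x (s x).2 (s x).1 = 0 by rewrite innerC.
have [t1 t2] := frame_tangent Ux; have [Xn0 XX] := Xof_lightlike Ux.
have eX : k *: Xof s x = k *: (s x).1 + k *: (s x).2 by rewrite -scalerDr.
pose Y := - k *: (s x).1 + k *: (s x).2.
right; split; first by rewrite eX; exact: tangent_comb.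
  split; last by rewrite innerZl innerZr XX !mulr0.
  by move/eqP; rewrite scaler_eq0 (negbTE k0) => /eqP.
have kk : 0 < k * k by rewrite -expr2 exprn_even_gt0.
exists Y; split; first exact: tangent_comb.
- split; last by rewrite !(innerDl, innerDr, innerZl, innerZr) n1 n2 n12 n21; ring.
  move/(congr1 (inner g x (s x).1)); rewrite innerDr !innerZr n1 n12.
  rewrite -[X in _ = inner _ _ _ X](scale0r (s x).1) innerZr => e.
  by move/eqP: k0; apply; lra.
- rewrite positively_orientedE eX area_comb pmulr_rgt0; last by lra.
  by rewrite -positively_orientedE; case: hs => /(_ x Ux) [[]].
- rewrite /spacelike eX !(innerDl, innerDr, innerZl, innerZr) n1 n2 n12 n21; lra.
Qed.

End LocalFrame.
End Frames.

(** * Frames from null fields, and gluing of local null fields *)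

Section Construction.
Context {R : realType} {M : surface R} (g : lorentz_metric M).

(** Write [w = p v1 + q v2] with [p^2 = q^2]. Then [v1 + v2 + w] has square [2 (q - p)], and the
    area of [(v1 + v2, w)] is [q - p] times that of [(v1, v2)]: the first is positive, so the two
    areas have the same sign. *)
Lemma orthonormal_oriented (x : M) v1 v2 w : tangent x v1 -> tangent x v2 ->
  orthonormal g x v1 v2 -> tangent x w -> inner g x w w = 0 ->
  positively_oriented x (v1 + v2) w -> spacelike g x (v1 + v2 + w) ->
  positively_oriented x v1 v2.
Proof.
move=> t1 t2 o tw ww; have ew := frame_expansion t1 t2 tw o.
have [n1 n2 n12] := o; have n21 : inner g x v2 v1 = 0 by rewrite innerC.
move: ew; set p := - _; set q := inner g x w v2 => ew.
have ev : v1 + v2 = 1 *: v1 + 1 *: v2 by rewrite !scale1r.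
rewrite /spacelike !positively_orientedE ev ew area_comb => ow.
move: ww; rewrite ew !(innerDl, innerDr, innerZl, innerZr) n1 n2 n12 n21 => ww sw.
by move: ow; rewrite pmulr_rgt0 //; lra.
Qed.

(* The complementary null field Y is the combination of X and a timelike T
   normalised by g(X, Y) = 2; then X = s_1 + s_2 and Y = - s_1 + s_2. *)
Lemma frame_of_Xfield (X : M -> components M) : time_orientable g ->
  nonvanishing_Xfield g X -> exists s, frame_section g s /\ Xof s = X.
Proof.
move=> [T [vT tT]] [vX dX].
have XP x : [/\ tangent x (X x), lightlike g x (X x) & exists w,
    [/\ tangent x w, lightlike g x w, positively_oriented x (X x) w &
        spacelike g x (X x + w)]].
  by case: (dX x) => -[].
pose m x := inner g x (X x) (T x).
have m0 x : m x != 0.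
  by have [tX lX _] := XP x; apply: lightlike_timelike => //; exact: vT.1.
(* [a T + b X] is Y / 2: [a] makes its product with [X] equal to 1, and [b] makes it null. *)
pose a x := (m x)^-1; pose b x := - 2^-1 * inner g x (T x) (T x) * (a x * a x).
have sa : smooth_fun_on setT a.
  by apply: smooth_fun_onV => //; [exact: openT|apply: inner_smooth => //; exact: openT].
have sb : smooth_fun_on setT b.
  do 2?[apply: smooth_fun_onM; try exact: openT] => //.
  - exact/smooth_fun_on_cst/openT.
  - by apply: inner_smooth => //; exact: openT.
have sc (k : R) (f : M -> R) : smooth_fun_on setT f -> smooth_fun_on setT (fun x => k + f x).
  by move=> sf; apply: smooth_fun_onD => //; [exact: openT|exact/smooth_fun_on_cst/openT].
have sN (f : M -> R) : smooth_fun_on setT f -> smooth_fun_on setT (fun x => -1 * f x).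
  by move=> sf; apply: smooth_fun_onM => //; [exact: openT|exact/smooth_fun_on_cst/openT].
pose s x := ((2^-1 + -1 * b x) *: X x + (-1 * a x) *: T x,
             (2^-1 + b x) *: X x + a x *: T x).
have XofX x : Xof s x = X x.
  rewrite /Xof /= addrACA -!scalerDl.
  rewrite (_ : -1 * a x + a x = 0) ?scale0r ?addr0; last by ring.
  by rewrite (_ : _ + _ = 1) ?scale1r //; field.
exists s; split; last exact/funext.
split=> [x _||].
- have [tX [_ XX] [w [tw [_ ww] ow sw]]] := XP x.
  have TX : inner g x (T x) (X x) = m x by rewrite innerC.
  have tT1 : tangent x (T x) by exact: vT.1.
  have o : orthonormal g x (s x).1 (s x).2.
    split; rewrite /s /= !(innerDl, innerDr, innerZl, innerZr) XX TX -/(m x) /b /a;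
    by field; rewrite ?m0.
  have t1 : tangent x (s x).1 by exact: tangent_comb.
  have t2 : tangent x (s x).2 by exact: tangent_comb.
  split; last by case: o.
  split=> //.
  apply: (orthonormal_oriented (w := w)) => //; by rewrite -[_.1 + _.2]/(Xof s x) XofX.
- by apply: vector_field_on_comb => //; [exact: openT|exact/sc/sN|exact/sN].
- by apply: vector_field_on_comb => //; [exact: openT|exact/sc].
Qed.

(* The local fields h X_s agree on overlaps only up to sign, because Spin(1,1)
   covers both components of SO(1,1); the sign of g(X_s, T) corrects this. *)
Lemma glue_weighted_Xof (I : Type) (U : I -> set M) (s : I -> M -> frame)
    (h : I -> M -> R) : time_orientable g ->
  (forall i, open (U i)) -> (forall x, exists i, U i x) ->
  (forall i, frame_section_on g (U i) (s i)) ->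
  (forall i, smooth_fun_on (U i) (h i)) ->
  (forall i x, U i x -> 0 < h i x) ->
  (forall i j x, U i x -> U j x -> exists2 e : R, e ^+ 2 = 1 &
     h j x *: Xof (s j) x = e *: (h i x *: Xof (s i) x)) ->
  (forall i x, U i x -> dirderiv (h i) (Xof (s i) x) x +
     h i x * connection_form g (s i) (Xof (s i) x) x = 0) ->
  exists X, nonvanishing_Xfield g X /\ forall x, divergence g X x = 0.
Proof.
move=> [T [vT tT]] oU cU fs sh h0 hX dh.
pose u i x := inner g x (Xof (s i) x) (T x).
have vTU i : vector_field_on (U i) T by apply: vector_field_onS vT.
have vX i : vector_field_on (U i) (Xof (s i)) by exact: Xof_field.
have u0 i x : U i x -> u i x != 0.
  move=> Ux; apply: lightlike_timelike (tT x); [exact: (vX i).1|exact: (vTU i).1|].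
  exact: Xof_lightlike Ux.
pose idx x := projT1 (cid (cU x)).
have Uidx x : U (idx x) x := projT2 (cid (cU x)).
pose Z i x := h i x *: Xof (s i) x.
pose X x := Num.sg (u (idx x) x) *: Z (idx x) x.
(* Another index changes [Z] by a factor [e] with [e^2 = 1], which is its own sign; the sign of [u]
   changes by the same factor, and the two cancel. *)
have XE i x : U i x -> X x = Num.sg (u i x) *: Z i x.
  move=> Ux; have [e e1 E] := hX i _ x Ux (Uidx x).
  have E' := congr1 (inner g x ^~ (T x)) E; move: E'; rewrite /= !innerZl -/(u _ x) -/(u _ x).
  move/(congr1 Num.sg); rewrite !sgrM !(gtr0_sg (h0 _ _ _)) // !mul1r => su.
  have se : Num.sg e = e.
    have /eqP : (e - 1) * (e + 1) = 0 by rewrite -subr_sqr e1 expr1n subrr.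
    rewrite mulf_eq0 subr_eq0 addr_eq0 => /orP[]/eqP->; first exact: sgr1.
    by rewrite sgrN sgr1.
  by rewrite /X /Z su E se !scalerA -[RHS]scale1r -e1 scalerA; congr (_ *: _); ring.
pose e x := Num.sg (u (idx x) x).
have e0 x : e x != 0 by rewrite sgr_eq0 u0.
(* [X] is chosen pointwise. On [W x], where [u] keeps its sign at [x], it is a constant multiple of
   a single [Z], so that smoothness and divergence can be computed there. *)
pose W x := U (idx x) `&` [set z | 0 < e x * u (idx x) z].
have oW x : open (W x).
  rewrite openE => z [Uz ez]; rewrite /interior /W.
  have cu : {for z, continuous (u (idx x))}.
    apply: (@smooth_fun_on_continuous _ _ _ (U (idx x))) => //.
    exact: inner_smooth.
  have ceu : {for z, continuous (fun z => e x * u (idx x) z)}.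
    by apply: cvgM; [exact: cvg_cst|exact: cu].
  apply: filterI; first exact: open_nbhs_nbhs.
  apply: (ceu [set r | 0 < r]); apply: open_nbhs_nbhs; split; last exact: ez.
  exact: open_gt.
have Wx x : W x x.
  split; first exact: Uidx.
  by rewrite /= /e -normrEsg normr_gt0 u0.
have XW x z : W x z -> X z = e x *: Z (idx x) z.
  move=> [Uz ez]; rewrite (XE (idx x)) //; congr (_ *: _).
  move/gtr0_sg: ez; rewrite sgrM /e sgr_id => ez.
  have := sqr_sg (u (idx x) x); rewrite u0 // expr2 /= mulr1n => ee.
  by rewrite -[LHS]mul1r -[in LHS]ee -mulrA ez mulr1.
have vZ i : vector_field_on (U i) (Z i) by exact: vector_field_on_scale.
exists X; split; first split.
- apply: (@vector_field_on_local _ _ _ W (fun x z => cst (e x) z *: Z (idx x) z)) => // x.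
  apply: (@vector_field_onS _ _ (U (idx x))); first by move=> z [].
  by apply: vector_field_on_scale => //; exact: smooth_fun_on_cst.
- move=> x; have k0 : e x * h (idx x) x != 0.
    by rewrite mulf_neq0 //; exact: lt0r_neq0 (h0 _ _ (Uidx x)).
  rewrite (XW x x) // scalerA; split; first exact: Xof_Xdistribution (Uidx x) k0.
  move/eqP; rewrite scaler_eq0 (negbTE k0) /= => /eqP.
  by have [] := Xof_lightlike (fs (idx x)) (Uidx x).
(* The product rule, for the constant sign and then for [h], leaves the expression that [dh] makes
   zero. *)
- move=> x; rewrite (divergence_near g (oW x) (Wx x) (XW x)).
  have sc : smooth_fun_on (U (idx x)) (cst (e x)) by exact: smooth_fun_on_cst.
  rewrite (divergence_scale g (oU (idx x)) (Uidx x) sc (vZ _)).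
  rewrite (divergence_scale g (oU (idx x)) (Uidx x) (sh _) (vX _)).
  rewrite (divergence_Xof (oU (idx x)) (fs _) (Uidx x)) dh // mulr0 addr0.
  exact: derive_cst.
Qed.

End Construction.

(** * Spin(1,1) as a group of diagonal matrices, and its covering of SO(1,1) *)

Section SpinGroup.
Context {R : realType}.
Local Notation C := R[i].
Local Notation iC := ('i%C : R[i]).

Lemma iCiC : iC * iC = -1.
Proof. by rewrite -expr2 sqr_i. Qed.

Definition diag2 (a b : R) : 'M[C]_2 :=
  \matrix_(i < 2, j < 2) (if i != j then 0 else if i == 0 then a%:C%C else b%:C%C).

(** Both Clifford generators share the factor [i]; with it split off, the parameters are real, and
    products of two such matrices are real diagonal. *)
Definition antidiag2 (a b : R) : 'M[C]_2 :=
  \matrix_(i < 2, j < 2) (if i == j then 0 else iC * (if i == 0 then a%:C%C else b%:C%C)).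

Lemma matrix2P (K : Type) (A B : 'M[K]_2) : A 0 0 = B 0 0 -> A 0 1 = B 0 1 ->
  A 1 0 = B 1 0 -> A 1 1 = B 1 1 -> A = B.
Proof. by move=> *; apply/matrixP => i j; elim/ord2P: i; elim/ord2P: j. Qed.

Lemma cl1E : cl1 = antidiag2 1 (-1).
Proof. by apply: matrix2P; rewrite !mxE /= ?rmorphN ?rmorph1; ring. Qed.

Lemma cl2E : cl2 = antidiag2 1 1.
Proof. by apply: matrix2P; rewrite !mxE /= ?rmorph1; ring. Qed.

(** The two parameters are the null coordinates of [v]; their product is [minkowski v]. *)
Lemma cliffordE (v : 'cV[R]_2) : clifford v = antidiag2 (v 0 0 + v 1 0) (v 1 0 - v 0 0).
Proof.
apply: matrix2P; rewrite /clifford cl1E cl2E !mxE /= ?rmorphB ?rmorphD ?rmorphN ?rmorph1;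
by ring.
Qed.

Lemma antidiag2M a b a' b' :
  antidiag2 a b *m antidiag2 a' b' = diag2 (- (a * b')) (- (b * a')).
Proof.
apply: matrix2P; rewrite !(mxE, sum2E) /= ?rmorphN ?rmorphM /=; try ring.
  by rewrite mul0r add0r mulrACA iCiC; ring.
by rewrite mul0r addr0 mulrACA iCiC; ring.
Qed.

Lemma diag2M a b a' b' : diag2 a b *m diag2 a' b' = diag2 (a * a') (b * b').
Proof. by apply: matrix2P; rewrite !(mxE, sum2E) /= ?rmorphM /=; ring. Qed.

Lemma diag2_1 : diag2 1 1 = 1%:M.
Proof. by apply: matrix2P; rewrite !mxE /=. Qed.

Lemma clomegaE : clomega = diag2 (-1) 1 :> 'M[C]_2.
Proof. by rewrite /clomega cl1E cl2E antidiag2M; congr diag2; ring. Qed.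

Lemma diag2_unit (a b : R) : a != 0 -> b != 0 -> diag2 a b \in unitmx.
Proof.
move=> a0 b0; have E : diag2 a b *m diag2 a^-1 b^-1 = 1%:M.
  by rewrite diag2M !mulfV // diag2_1.
by case/mulmx1_unit: E.
Qed.

Lemma invmx_diag2 (a b : R) : a != 0 -> b != 0 -> invmx (diag2 a b) = diag2 a^-1 b^-1.
Proof.
move=> a0 b0; have u := diag2_unit a0 b0.
by rewrite -[RHS](mulKmx u) diag2M !mulfV // diag2_1 mulmx1.
Qed.

(** Taken in pairs, the vectors multiply to diagonal matrices whose determinants are products of
    values of [minkowski]. The square allows both components, [al be = 1] and [al be = -1]. *)
Lemma SpinP (a : 'M[C]_2) :
  Spin a <-> exists al be : R, a = diag2 al be /\ (al * be) ^+ 2 = 1.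
Proof.
have mink (v : 'cV[R]_2) : minkowski v = (v 0 0 + v 1 0) * (v 1 0 - v 0 0).
  by rewrite /minkowski; ring.
split=> [[vs [ev nv ->]]|[al [be [-> ab]]]].
  have [n en] : exists n, size vs = n.*2.
    by exists (size vs)./2; rewrite -[LHS]odd_double_half (negbTE ev).
  elim: n vs {ev} en nv => [|n IH] vs.
    move/size0nil => -> _; exists 1, 1; rewrite big_nil mulr1 expr1n.
    by rewrite diag2_1.
  case: vs => [|v [|w vs]] // [en] nv.
  rewrite !big_cons; have [|al [be [-> ab]]] := IH vs en.
    by move=> z zvs; apply: nv; rewrite !inE zvs !orbT.
  rewrite !cliffordE mulrA.
  have -> : antidiag2 (v 0 0 + v 1 0) (v 1 0 - v 0 0) *
     antidiag2 (w 0 0 + w 1 0) (w 1 0 - w 0 0) * diag2 al be =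
     antidiag2 (v 0 0 + v 1 0) (v 1 0 - v 0 0) *m
     antidiag2 (w 0 0 + w 1 0) (w 1 0 - w 0 0) *m diag2 al be by [].
  rewrite antidiag2M diag2M; eexists; eexists; split; first reflexivity.
  have sq z : z \in [:: v, w & vs] -> minkowski z ^+ 2 = 1.
    by move=> /nv[] ->; rewrite ?sqrrN expr1n.
  (* The regrouping brings together the two null coordinates of each vector. *)
  have -> : forall p q r t : R, (- (p * q) * al * (- (r * t) * be)) ^+ 2 =
    (p * r) ^+ 2 * (t * q) ^+ 2 * (al * be) ^+ 2 by move=> *; ring.
  rewrite -!mink ab !sq ?mulr1 // !inE eqxx ?orbT //.
(* [w] is e_2, with null coordinates 1 and 1, and [v] has null coordinates [- al] and [- be]; hence
   their product is [diag2 al be] and [minkowski v = al * be]. *)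
pose v : 'cV[R]_2 := \col_i (if i == 0 then (be - al) / 2 else - (al + be) / 2).
pose w : 'cV[R]_2 := \col_i (if i == 0 then 0 else 1).
exists [:: v; w]; split=> //.
  move=> z; rewrite !inE => /orP[]/eqP ->; rewrite mink !mxE /=; last by left; ring.
  have /eqP : (al * be - 1) * (al * be + 1) = 0 by rewrite -subr_sqr ab expr1n subrr.
  rewrite mulf_eq0 subr_eq0 addr_eq0 => /orP[]/eqP E;
    [left|right]; by rewrite -[RHS]E; field.
rewrite !big_cons big_nil mulr1 !cliffordE [_ * _]antidiag2M !mxE /=.
by congr diag2; field.
Qed.

Lemma spin_neq0 (al be : R) : (al * be) ^+ 2 = 1 -> al != 0 /\ be != 0.
Proof.
move=> E; have : al * be != 0 by rewrite -sqrf_eq0 E oner_neq0.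
by rewrite mulf_eq0 negb_or => /andP.
Qed.

Lemma Spin1 : Spin (1%:M : 'M[C]_2).
Proof. by apply/SpinP; exists 1, 1; rewrite diag2_1 mulr1 expr1n. Qed.

Lemma SpinM (a b : 'M[C]_2) : Spin a -> Spin b -> Spin (a *m b).
Proof.
move=> /SpinP[p [q [-> pq]]] /SpinP[r [t [-> rt]]]; apply/SpinP.
exists (p * r), (q * t); rewrite diag2M; split=> //.
by rewrite mulrACA exprMn pq rt mulr1.
Qed.

Lemma SpinV (a : 'M[C]_2) : Spin a -> Spin (invmx a).
Proof.
move=> /SpinP[p [q [-> pq]]]; have [p0 q0] := spin_neq0 pq; apply/SpinP.
exists p^-1, q^-1; rewrite invmx_diag2 //; split=> //.
by rewrite -invfM exprVn pq invr1.
Qed.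

Lemma Spin_unit (a : 'M[C]_2) : Spin a -> a \in unitmx.
Proof. by move=> /SpinP[p [q [-> /spin_neq0[]]]]; exact: diag2_unit. Qed.

Lemma iC_inj (a b : C) : iC * a = iC * b -> a = b.
Proof. by move/(congr1 ( *%R iC)); rewrite !mulrA iCiC !mulN1r => /oppr_inj. Qed.

Lemma diag2_conj al be (a b : R) : al != 0 -> be != 0 ->
  diag2 al be *m antidiag2 a b *m invmx (diag2 al be) =
  antidiag2 (al / be * a) (be / al * b).
Proof.
move=> al0 be0; rewrite invmx_diag2 //.
by apply: matrix2P; rewrite !(mxE, sum2E) /= ?rmorphM /=; ring.
Qed.

Lemma antidiag2_inj a b a' b' : antidiag2 a b = antidiag2 a' b' -> a = a' /\ b = b'.
Proof.
move/matrixP => E; have := E 0 1; have := E 1 0; rewrite !mxE /=.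
by move=> /iC_inj/complexI -> /iC_inj/complexI ->.
Qed.

(** For [a = diag2 al be] and [r = al / be] this is the boost that multiplies X_s by [r] and Y_s by
    [1 / r], composed with minus the identity when [r < 0]. *)
Definition cover_mx (a : 'M[C]_2) : 'M[R]_2 :=
  let r := complex.Re (a 0 0) / complex.Re (a 1 1) in
  \matrix_(i < 2, j < 2) (2^-1 * (if i == j then r + r^-1 else r - r^-1)).

Lemma cover_mx_spin_cover (a : 'M[C]_2) : Spin a -> spin_cover a (cover_mx a).
Proof.
move=> /SpinP[p [q [-> /spin_neq0[p0 q0]]]] v.
rewrite !cliffordE diag2_conj // !(mxE, sum2E) /=.
by congr antidiag2; field; rewrite p0 q0.
Qed.

Lemma cover_mxM (a b : 'M[C]_2) : Spin a -> Spin b ->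
  cover_mx (a *m b) = cover_mx a *m cover_mx b.
Proof.
move=> /SpinP[p [q [-> /spin_neq0[p0 q0]]]] /SpinP[r [t [-> /spin_neq0[r0 t0]]]].
rewrite diag2M; apply: matrix2P; rewrite !(mxE, sum2E) /=; field;
by rewrite p0 q0 r0 t0.
Qed.

Lemma cover_mx1 : cover_mx 1%:M = 1%:M.
Proof. by apply: matrix2P; rewrite !mxE /=; field. Qed.

(** The vector (1, 1) holds the coordinates of X_s; its Clifford matrix has a single nonzero entry,
    which conjugation multiplies by [al / be]. *)
Lemma spin_cover_null (al be : R) A : al != 0 -> be != 0 -> spin_cover (diag2 al be) A ->
  A 0 0 + A 0 1 = al / be /\ A 1 0 + A 1 1 = al / be.
Proof.
move=> al0 be0 /(_ (const_mx 1)); rewrite !cliffordE diag2_conj //.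
by move=> /antidiag2_inj; rewrite !(mxE, sum2E) => -[E1 E2]; split; lra.
Qed.

End SpinGroup.

(** * The trivial spin structure over a global frame *)

Section TrivialSpinStructure.
Context {R : realType} {M : surface R} (g : lorentz_metric M).
Implicit Types (t : @frame R M).

Lemma frame_actM t A B : frame_act (frame_act t A) B = frame_act t (A *m B).
Proof.
rewrite /frame_act /= !(mxE, sum2E) !scalerDr !scalerA; congr pair; rewrite addrACA -!scalerDl;
by congr (_ *: _ + _ *: _); ring.
Qed.

Lemma frame_act1 t : frame_act t 1%:M = t.
Proof. by case: t => v w; rewrite /frame_act !mxE /= !scale1r !scale0r addr0 add0r. Qed.

(** The matrix preserves the Minkowski form and has determinant 1 for either sign of [r], so
    orientation survives even where time is reversed. *)
Lemma Pfibre_cover x t a : Spin a -> Pfibre g x t ->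
  Pfibre g x (frame_act t (cover_mx a)).
Proof.
move=> /SpinP[p [q [-> /spin_neq0[p0 q0]]]] [[t1 t2 ot] [n1 n2 n12]].
have n21 : inner g x t.2 t.1 = 0 by rewrite innerC.
split; split; rewrite /frame_act /=.
- exact: tangent_comb.
- exact: tangent_comb.
- rewrite positively_orientedE in ot; rewrite positively_orientedE area_comb pmulr_rgt0 //.
  by rewrite [X in 0 < X](_ : _ = 1) // !mxE /=; field; rewrite p0 q0.
- rewrite !(innerDl, innerDr, innerZl, innerZr) n1 n2 n12 n21 !mxE /=.
  by field; rewrite p0 q0.
- rewrite !(innerDl, innerDr, innerZl, innerZr) n1 n2 n12 n21 !mxE /=.
  by field; rewrite p0 q0.
- rewrite !(innerDl, innerDr, innerZl, innerZr) n1 n2 n12 n21 !mxE /=.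
  by field; rewrite p0 q0.
Qed.

Variables (s : M -> @frame R M) (hs : frame_section g s).

Definition trivialQ : Type := (M * {a : 'M[R[i]]_2 | Spin a})%type.

Definition trivial_pr (q : trivialQ) : M := q.1.

(* acts trivially by matrices outside Spin(1,1) *)
Definition trivial_act (q : trivialQ) (a : 'M[R[i]]_2) : trivialQ :=
  match pselect (Spin a) with
  | left ha => (q.1, exist _ (sval q.2 *m a) (SpinM (svalP q.2) ha))
  | right _ => q
  end.

Definition trivial_sigma (_ : unit) (x : M) : trivialQ := (x, exist _ 1%:M Spin1).

Definition trivial_Lambda (q : trivialQ) : @frame R M :=
  frame_act (s q.1) (cover_mx (sval q.2)).

Lemma trivialQ_eq (q q' : trivialQ) : q.1 = q'.1 -> sval q.2 = sval q'.2 -> q = q'.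
Proof.
case: q q' => [x [a ha]] [y [b hb]] /= -> ab; congr pair.
exact: eq_exist.
Qed.

Lemma trivial_actE q a : Spin a ->
  (trivial_act q a).1 = q.1 /\ sval (trivial_act q a).2 = sval q.2 *m a.
Proof. by rewrite /trivial_act; case: pselect. Qed.

Lemma trivial_act1 q : trivial_act q 1%:M = q.
Proof.
by have [e1 e2] := trivial_actE q Spin1; apply: trivialQ_eq; rewrite ?e2 ?mulmx1.
Qed.

Lemma trivial_actM q a b : Spin a -> Spin b ->
  trivial_act (trivial_act q a) b = trivial_act q (a *m b).
Proof.
move=> ha hb; have [e1 e2] := trivial_actE q ha.
have [e3 e4] := trivial_actE (trivial_act q a) hb.
have [e5 e6] := trivial_actE q (SpinM ha hb).
by apply: trivialQ_eq; [rewrite e3 e1 e5|rewrite e4 e2 e6 mulmxA].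
Qed.

Lemma trivial_pr_act q a : Spin a -> trivial_pr (trivial_act q a) = trivial_pr q.
Proof. by move=> /(trivial_actE q)[]. Qed.

Lemma trivial_act_simply_transitive q q' : trivial_pr q = trivial_pr q' ->
  exists! a, Spin a /\ trivial_act q a = q'.
Proof.
move=> e; have ha := svalP q.2; have hb := svalP q'.2.
have u := Spin_unit ha.
exists (invmx (sval q.2) *m sval q'.2); split.
  have hc := SpinM (SpinV ha) hb; split=> //; have [e1 e2] := trivial_actE q hc.
  by apply: trivialQ_eq; [rewrite e1|rewrite e2 mulKVmx].
by move=> a [hc <-]; have [_ ->] := trivial_actE q hc; rewrite mulKmx.
Qed.

Lemma trivial_sigma_transition (k l : unit) : exists a : M -> 'M[R[i]]_2,
  csmooth_on (setT `&` setT) a /\ forall x, [set: M] x -> [set: M] x ->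
  Spin (a x) /\ trivial_sigma l x = trivial_act (trivial_sigma k x) (a x).
Proof.
exists (cst 1%:M); split=> [i j|x _ _]; last by rewrite trivial_act1; split=> //; exact: Spin1.
by split; apply: smooth_fun_on_cst; rewrite setTI; exact: openT.
Qed.

Lemma trivial_Lambda_fibre q : Pfibre g (trivial_pr q) (trivial_Lambda q).
Proof. by apply: Pfibre_cover; [exact: svalP|case: hs => h _ _; exact: h]. Qed.

Lemma trivial_Lambda_equivariant q a : Spin a -> exists A,
  spin_cover a A /\ trivial_Lambda (trivial_act q a) = frame_act (trivial_Lambda q) A.
Proof.
move=> ha; exists (cover_mx a); split; first exact: cover_mx_spin_cover.
have [e1 e2] := trivial_actE q ha; rewrite /trivial_Lambda e1 e2 frame_actM cover_mxM //.
exact: svalP.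
Qed.

Lemma trivial_Lambda_sigma k : trivial_Lambda \o trivial_sigma k = s.
Proof. by apply/funext => x; rewrite /= /trivial_Lambda /= cover_mx1 frame_act1. Qed.

Lemma trivial_Lambda_smooth (k : unit) :
  frame_section_on g setT (trivial_Lambda \o trivial_sigma k).
Proof. by rewrite trivial_Lambda_sigma. Qed.

Definition trivial_spin_structure : spin_structure g :=
  @SpinStructure R M g trivialQ trivial_pr trivial_act trivial_act1 trivial_actM
    trivial_pr_act trivial_act_simply_transitive unit (fun=> setT) trivial_sigma
    (fun=> openT) (fun x => ex_intro _ tt I) (fun _ _ _ => erefl)
    trivial_sigma_transition trivial_Lambda trivial_Lambda_fibre
    trivial_Lambda_equivariant trivial_Lambda_smooth.

End TrivialSpinStructure.

(** * Spinor fields under a change of trivialization *)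

Section SpinorClasses.
Context {R : realType} {M : surface R} {g : lorentz_metric M} {Sp : spin_structure g}.

Lemma spinor_class_refl (q : Q Sp) w : spinor_class q w (q, w).
Proof.
exists 1%:M; split; first exact: Spin1.
by rewrite act1 invmx1 mul1mx.
Qed.

(** Representatives over the same [q] differ by a spin element fixing [q], which is 1 because the
    action is free. *)
Lemma spinor_class_inj (q : Q Sp) w w' : spinor_class q w = spinor_class q w' -> w = w'.
Proof.
move=> E; have := spinor_class_refl q w; rewrite E => -[a [ha [qa ->]]].
have [b [_ ub]] := act_simply_transitive (erefl (pr q)).
have -> : a = 1%:M.
  by rewrite -(ub a) // (ub 1%:M) //; split; [exact: Spin1|exact: act1].
by rewrite invmx1 mul1mx.
Qed.

(** From these weights, |f_0|^2 X_s is multiplied by [1 / (al be)] and X_s / |f_1|^2 by [al be],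
    both of which are signs. *)
Lemma spinor_coord_transition varphi k l (f f' : M -> @spinor_module R) x :
  @spinor_coord R M g Sp varphi k f -> spinor_coord varphi l f' ->
  triv k x -> triv l x -> exists al be : R, [/\ (al * be) ^+ 2 = 1,
    f' x 0 0 = (al^-1)%:C%C * f x 0 0, f' x 1 0 = (be^-1)%:C%C * f x 1 0 &
    Xof (sframe l) x = (al / be) *: Xof (sframe k) x].
Proof.
move=> hf hf' kx lx; have := spinor_class_refl (sigma l x) (f' x).
rewrite -(hf' x lx) (hf x kx) => -[a [ha [ea ef]]].
have [A [cA eL]] := Lambda_equivariant (sigma k x) ha.
move: ha ea cA eL ef => /SpinP[al [be [-> ab]]] ea cA eL ef.
have [al0 be0] := spin_neq0 ab; exists al, be; rewrite ef invmx_diag2 //.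
have [A1 A2] := spin_cover_null al0 be0 cA.
split=> //; try by rewrite !(mxE, sum2E) /=; ring.
rewrite /Xof /sframe ea eL /frame_act /= addrACA -!scalerDl A1 A2 scalerDr //.
Qed.
End SpinorClasses.

(** * Directional derivatives of real functions *)

Section DirectionalDerivative.
Context {R : realType} {M : surface R} {U : set M} {x : M} (Ux : U x).

Lemma dirderiv_comb (f : M -> R) (a b : R) v w : smooth_fun_on U f ->
  dirderiv f (a *: v + b *: w) x = a * dirderiv f v x + b * dirderiv f w x.
Proof.
move=> sf; have df := smooth_fun_on_differentiable sf (dom_chart_at x) Ux.
by rewrite /dirderiv fctE derive_additive // !derive_homogeneous.
Qed.

Lemma dirderiv_sqnorm (f h : M -> R) v : smooth_fun_on U f -> smooth_fun_on U h ->
  dirderiv (fun z => f z * f z + h z * h z) v x =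
  2 * (f x * dirderiv f v x + h x * dirderiv h v x).
Proof.
move=> sf sh; have cx := dom_chart_at x.
have df := diff_derivable (smooth_fun_on_differentiable sf cx Ux).
have dh := diff_derivable (smooth_fun_on_differentiable sh cx Ux).
rewrite /dirderiv; set c := chart_at x in cx df dh *.
rewrite (_ : _ \o _ = (f \o psi c) * (f \o psi c) + (h \o psi c) * (h \o psi c)) //.
rewrite deriveD; try exact: derivableM.
rewrite !deriveM // /= phiK // /GRing.scale /=.
move: (derive (f \o _) _ _) (derive (h \o _) _ _) => p q; ring.
Qed.

Lemma dirderivV (f : M -> R) v : smooth_fun_on U f -> f x != 0 ->
  dirderiv (fun z => (f z)^-1) v x = - (f x) ^- 2 * dirderiv f v x.
Proof.
move=> sf f0; have cx := dom_chart_at x.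
have df := diff_derivable (smooth_fun_on_differentiable sf cx Ux).
rewrite /dirderiv -[_ \o _]/(fun y => ((f \o psi (chart_at x)) y)^-1).
by rewrite deriveV // /= ?phiK.
Qed.

End DirectionalDerivative.

(** * The spinor connection and the Dirac operator in components *)

Lemma complex0 {R : realType} (a b : R) : (a +i* b)%C = 0 -> a = 0 /\ b = 0.
Proof. by case. Qed.

Lemma complex_affine_comb {R : realType} (c a b p q p' q' w w' r t : R) :
  Complex (a * p + b * p' + c * (a * w + b * w') * r)
          (a * q + b * q' + c * (a * w + b * w') * t) =
  a%:C%C * Complex (p + c * w * r) (q + c * w * t) +
  b%:C%C * Complex (p' + c * w' * r) (q' + c * w' * t).
Proof. by simpc; congr Complex; ring. Qed.

Lemma iC_mul_sum {R : realType} (n1 n2 : R[i]) :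
  'i%C * (n1 + n2) = 'i%C * ((1 : R)%:C%C * n1 + (1 : R)%:C%C * n2).
Proof. by rewrite rmorph1 !mul1r. Qed.

(** The scalar identity behind [twistor_residual]: [- p] and [q] are the frame coordinates of [v],
    and [n1], [n2] the second components of the derivatives along s_1 and s_2. *)
Lemma twistor_residual_algebra {R : realType} (p q : R) (n1 n2 : R[i]) :
  (- p)%:C%C * n1 + q%:C%C * n2 +
    (2^-1 : R)%:C%C * ('i%C * (q + p)%:C%C * ('i%C * (n2 - n1))) =
  (2^-1 * (q - p))%:C%C * ((1 : R)%:C%C * n1 + (1 : R)%:C%C * n2).
Proof.
have ii (a b : R[i]) : 'i%C * a * ('i%C * b) = - (a * b).
  by rewrite mulrACA iCiC mulN1r.
rewrite rmorph1 !mul1r ii rmorphM rmorphD rmorphB rmorphN fmorphV rmorph_nat.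
by field.
Qed.

Section SpinorDerivatives.
Context {R : realType} {M : surface R} {g : lorentz_metric M} (Sp : spin_structure g).
Variables (k : triv_index Sp) (f : M -> @spinor_module R) (x : M).
Let w v := connection_form g (sframe k) v x.

(** [clomega] is diag(-1, 1), so the connection term of [nablaS] has weight 1/2 on the first
    component and -1/2 on the second. *)
Lemma nablaS_coord0 v : nablaS k v f x 0 0 =
  Complex (dirderiv (fun z => complex.Re (f z 0 0)) v x + 2^-1 * w v * complex.Re (f x 0 0))
          (dirderiv (fun z => complex.Im (f z 0 0)) v x + 2^-1 * w v * complex.Im (f x 0 0)).
Proof.
rewrite /nablaS /cdirderiv clomegaE !(mxE, sum2E) /= -/(connection_form g (sframe k) v x) -/(w v).
by case: (f x 0 0) => a b; simpc; congr Complex; rewrite /=; ring.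
Qed.

Lemma nablaS_coord1 v : nablaS k v f x 1 0 =
  Complex (dirderiv (fun z => complex.Re (f z 1 0)) v x + - 2^-1 * w v * complex.Re (f x 1 0))
          (dirderiv (fun z => complex.Im (f z 1 0)) v x + - 2^-1 * w v * complex.Im (f x 1 0)).
Proof.
rewrite /nablaS /cdirderiv clomegaE !(mxE, sum2E) /= -/(connection_form g (sframe k) v x) -/(w v).
by case: (f x 1 0) => a b; simpc; congr Complex; rewrite /=; ring.
Qed.

Lemma Dirac_coord0 : Dirac k f x 0 0 =
  'i%C * (nablaS k (sframe k x).2 f x 1 0 - nablaS k (sframe k x).1 f x 1 0).
Proof.
rewrite /Dirac cl1E cl2E.
move: (nablaS k (sframe k x).1 f x) (nablaS k (sframe k x).2 f x) => n1 n2.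
by rewrite !(mxE, sum2E) /=; ring.
Qed.

Lemma Dirac_coord1 : Dirac k f x 1 0 =
  'i%C * (nablaS k (sframe k x).1 f x 0 0 + nablaS k (sframe k x).2 f x 0 0).
Proof.
rewrite /Dirac cl1E cl2E.
move: (nablaS k (sframe k x).1 f x) (nablaS k (sframe k x).2 f x) => n1 n2.
by rewrite !(mxE, sum2E) /= ?rmorphN ?rmorph1; ring.
Qed.

Hypotheses (kx : triv k x) (sf : csmooth_on (triv k) f).

Let ot : open (triv k) := triv_open k.
Let hs : frame_section_on g (triv k) (sframe k) := Lambda_smooth k.

Lemma nablaS_comb0 (a b : R) v u : nablaS k (a *: v + b *: u) f x 0 0 =
  a%:C%C * nablaS k v f x 0 0 + b%:C%C * nablaS k u f x 0 0.
Proof.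
rewrite [LHS]nablaS_coord0 [X in _ = _ * X + _]nablaS_coord0.
rewrite [X in _ = _ + _ * X]nablaS_coord0 /w.
have [sr si] := sf 0 0.
rewrite (connection_form_comb ot hs _ _ _ _ kx).
rewrite (dirderiv_comb kx _ _ _ _ sr) (dirderiv_comb kx _ _ _ _ si).
exact: complex_affine_comb.
Qed.

Lemma nablaS_comb1 (a b : R) v u : nablaS k (a *: v + b *: u) f x 1 0 =
  a%:C%C * nablaS k v f x 1 0 + b%:C%C * nablaS k u f x 1 0.
Proof.
rewrite [LHS]nablaS_coord1 [X in _ = _ * X + _]nablaS_coord1.
rewrite [X in _ = _ + _ * X]nablaS_coord1 /w.
have [sr si] := sf 1 0.
rewrite (connection_form_comb ot hs _ _ _ _ kx).
rewrite (dirderiv_comb kx _ _ _ _ sr) (dirderiv_comb kx _ _ _ _ si).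
exact: complex_affine_comb.
Qed.

Lemma Xof_comb : Xof (sframe k) x = 1 *: (sframe k x).1 + 1 *: (sframe k x).2.
Proof. by rewrite !scale1r. Qed.

(** [- cl1] and [cl2] have the same lower left entry [i], so the derivatives along s_1 and s_2 add
    up to one along X_s. *)
Lemma Dirac_coord1_Xof : Dirac k f x 1 0 = 'i%C * nablaS k (Xof (sframe k) x) f x 0 0.
Proof.
rewrite Xof_comb [X in _ = _ * X]nablaS_comb0 [LHS]Dirac_coord1.
exact: iC_mul_sum.
Qed.

Lemma clifford_mul_coord1 v u : clifford_mul k x v u 1 0 =
  'i%C * (inner g x v (sframe k x).2 + inner g x v (sframe k x).1)%:C%C * u 0 0.
Proof.
rewrite /clifford_mul cliffordE !(mxE, sum2E) /= opprK; ring.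
Qed.

Lemma clifford_mul_coord0 v u : clifford_mul k x v u 0 0 =
  'i%C * (inner g x v (sframe k x).2 - inner g x v (sframe k x).1)%:C%C * u 1 0.
Proof.
rewrite /clifford_mul cliffordE !(mxE, sum2E) /= [- _ + _]addrC; ring.
Qed.

(* The residual nabla_v f + v . D f / 2 of the twistor equation only sees the
   X-component of v. *)
Lemma twistor_residual v : tangent x v ->
  nablaS k v f x 1 0 + (2^-1 : R)%:C%C * clifford_mul k x v (Dirac k f x) 1 0 =
  (2^-1 * (inner g x v (sframe k x).2 - inner g x v (sframe k x).1))%:C%C *
    nablaS k (Xof (sframe k) x) f x 1 0.
Proof.
move=> tv; have [t1 t2] := frame_tangent hs kx.
rewrite {1}(frame_expansion t1 t2 tv (frame_orthonormal hs kx)).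
rewrite Xof_comb [X in X + _ = _]nablaS_comb1 [X in _ = _ * X]nablaS_comb1.
rewrite [X in _ + _ * X = _]clifford_mul_coord1 [X in _ * (_ * X)]Dirac_coord0.
exact: twistor_residual_algebra.
Qed.

End SpinorDerivatives.

(** * Chiral spinors: divergence-free null fields from solutions, and constant solutions over a
    parallel frame *)

Definition sqnorm {R : realType} (z : R[i]) : R :=
  complex.Re z * complex.Re z + complex.Im z * complex.Im z.

Lemma sqnorm_gt0 {R : realType} (z : R[i]) : z != 0 -> 0 < sqnorm z.
Proof.
case: z => a b; rewrite /sqnorm /= -!expr2 => ab.
rewrite lt_neqAle addr_ge0 ?sqr_ge0 // andbT eq_sym.
by rewrite paddr_eq0 ?sqr_ge0 // !sqrf_eq0; apply: contra ab => /andP[/eqP-> /eqP->].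
Qed.

Lemma sqnormZ {R : realType} (k : R) (z : R[i]) : sqnorm (k%:C%C * z) = k ^+ 2 * sqnorm z.
Proof. by case: z => a b; rewrite /sqnorm; simpc; rewrite /=; ring. Qed.

(** If real and imaginary parts obey the equation of weight [c] along X_s, then |f|^2 has
    logarithmic derivative [- 2 c w]. For [c = 1/2] this balances div X_s against |f|^2, for
    [c = -1/2] against 1 / |f|^2. *)
Lemma sqnorm_flow {R : realType} (c w r t dr dt : R) :
  dr + c * w * r = 0 -> dt + c * w * t = 0 ->
  2 * (r * dr + t * dt) = - (2 * c) * w * (r * r + t * t).
Proof.
move=> er et; have -> : dr = - (c * w * r) by lra.
have -> : dt = - (c * w * t) by lra.
by ring.
Qed.

Section ChiralSpinors.
Context {R : realType} {M : surface R} {g : lorentz_metric M}.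

Lemma clomega_positive (w : @spinor_module R) : clomega *m w = - w <-> w 1 0 = 0.
Proof.
rewrite clomegaE; split=> [/matrixP/(_ 1 0)|w1].
  rewrite !(mxE, sum2E) /= rmorph1 mul0r add0r mul1r => /eqP.
  by rewrite -addr_eq0 -mulr2n mulrn_eq0 /= => /eqP.
apply/matrixP => i j; rewrite (ord1 j) !(mxE, sum2E).
by elim/ord2P: i => /=; rewrite w1 ?rmorphN ?rmorph1; ring.
Qed.

Lemma clomega_negative (w : @spinor_module R) : clomega *m w = w <-> w 0 0 = 0.
Proof.
rewrite clomegaE; split=> [/matrixP/(_ 0 0)|w1].
  rewrite !(mxE, sum2E) /= rmorphN rmorph1 mul0r addr0 mulN1r => /eqP.
  by rewrite eq_sym -addr_eq0 -mulr2n mulrn_eq0 /= => /eqP.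
apply/matrixP => i j; rewrite (ord1 j) !(mxE, sum2E).
by elim/ord2P: i => /=; rewrite w1 ?rmorphN ?rmorph1; ring.
Qed.

Lemma spinor_ext (w w' : @spinor_module R) :
  w 0 0 = w' 0 0 -> w 1 0 = w' 1 0 -> w = w'.
Proof.
by move=> w0 w1; apply/matrixP => i j; rewrite (ord1 j); elim/ord2P: i.
Qed.

Lemma spinor_eq0 (w : @spinor_module R) : w 0 0 = 0 -> w 1 0 = 0 -> w = 0.
Proof. by move=> w0 w1; apply: spinor_ext; rewrite mxE. Qed.

Lemma harmonic_Xfield (Sp : spin_structure g) varphi : time_orientable g ->
    @spinor_field R M g Sp varphi -> positive_spinor varphi -> harmonic varphi ->
    without_zeros varphi ->
  exists X, nonvanishing_Xfield g X /\ forall x, divergence g X x = 0.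
Proof.
move=> hT sv pv hv nv.
pose f k := projT1 (cid (sv k)).
have [sf cf] : (forall k, csmooth_on (triv k) (f k)) /\ (forall k, spinor_coord varphi k (f k)).
  by split=> k; have [] := projT2 (cid (sv k)).
have fx k x : triv k x -> varphi x (sigma k x, f k x).
  by move=> kx; rewrite (cf k x kx); exact: spinor_class_refl.
have f0 k x : triv k x -> f k x 0 0 != 0.
  move=> /fx kx; apply/eqP => f00; apply: (nv _ _ _ kx).
  by apply: spinor_eq0 => //; apply/clomega_positive; exact: pv kx.
pose h k x := sqnorm (f k x 0 0).
have sh k : smooth_fun_on (triv k) (h k).
  have [sr si] := sf k 0 0; have o := triv_open k.
  by apply: smooth_fun_onD => //; exact: smooth_fun_onM.
apply: (@glue_weighted_Xof _ _ _ _ (@triv _ _ _ Sp) (@sframe _ _ _ Sp) h) => //.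
- exact: triv_open.
- exact: triv_cover.
- exact: Lambda_smooth.
- by move=> k x kx; exact/sqnorm_gt0/f0.
- move=> k l x kx lx.
  have [al [be [ab e0 _ eX]]] := spinor_coord_transition (cf k) (cf l) kx lx.
  have [al0 be0] := spin_neq0 ab.
  exists (al * be)^-1; first by rewrite exprVn ab invr1.
  rewrite eX /h e0 sqnormZ !scalerA; congr (_ *: _).
  by field; rewrite al0 be0.
- move=> k x kx; have := Dirac_coord1_Xof kx (sf k).
  rewrite (hv k (f k) (cf k) x kx) [LHS]mxE -[LHS](mulr0 'i%C) => /iC_inj/esym.
  have [sr si] := sf k 0 0.
  rewrite [LHS]nablaS_coord0 => /complex0 [er ei].
  rewrite (dirderiv_sqnorm kx _ sr si) (sqnorm_flow er ei).
  by rewrite -/(sqnorm _) mulfV ?pnatr_eq0 // mulN1r mulNr mulrC addNr.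
Qed.

Lemma twistor_Xfield (Sp : spin_structure g) varphi : time_orientable g ->
    @spinor_field R M g Sp varphi -> negative_spinor varphi -> twistor varphi ->
    without_zeros varphi ->
  exists X, nonvanishing_Xfield g X /\ forall x, divergence g X x = 0.
Proof.
move=> hT sv pv hv nv.
pose f k := projT1 (cid (sv k)).
have [sf cf] : (forall k, csmooth_on (triv k) (f k)) /\ (forall k, spinor_coord varphi k (f k)).
  by split=> k; have [] := projT2 (cid (sv k)).
have fx k x : triv k x -> varphi x (sigma k x, f k x).
  by move=> kx; rewrite (cf k x kx); exact: spinor_class_refl.
have f0 k x : triv k x -> 0 < sqnorm (f k x 1 0).
  move=> /fx kx; apply/sqnorm_gt0/eqP => f10; apply: (nv _ _ _ kx).
  by apply: spinor_eq0 => //; apply/clomega_negative; exact: pv kx.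
pose h k x := (sqnorm (f k x 1 0))^-1.
have sn k : smooth_fun_on (triv k) (fun x => sqnorm (f k x 1 0)).
  have [sr si] := sf k 1 0; have o := triv_open k.
  by apply: smooth_fun_onD => //; exact: smooth_fun_onM.
apply: (@glue_weighted_Xof _ _ _ _ (@triv _ _ _ Sp) (@sframe _ _ _ Sp) h) => //.
- exact: triv_open.
- exact: triv_cover.
- exact: Lambda_smooth.
- move=> k; apply: smooth_fun_onV (sn k); first exact: triv_open.
  by move=> x kx; exact/lt0r_neq0/f0.
- by move=> k x kx; rewrite invr_gt0 f0.
- move=> k l x kx lx.
  have [al [be [ab _ e1 eX]]] := spinor_coord_transition (cf k) (cf l) kx lx.
  have [al0 be0] := spin_neq0 ab; have n0 := lt0r_neq0 (f0 k x kx).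
  exists (al * be) => //.
  rewrite eX /h e1 sqnormZ !scalerA; congr (_ *: _).
  by field; rewrite n0 be0.
(* The twistor equation is tested on the timelike [T], whose coefficient in [twistor_residual], half
   of g(T, s_2) - g(T, s_1), is nonzero. *)
- move=> k x kx; have [T [vT tT]] := hT.
  have tTx : tangent x (T x) by exact: vT.1.
  have n0 : nablaS k (Xof (sframe k) x) (f k) x 1 0 = 0.
    have := twistor_residual kx (sf k) tTx; rewrite (hv k (f k) (cf k) T vT x kx).
    set D := clifford_mul _ _ _ _; rewrite [X in X + _]mxE mulNr addNr => /esym/eqP.
    rewrite mulf_eq0 => /orP[|/eqP //]; rewrite -(rmorph0 (real_complex R)) => /eqP/complexI => e.
    have [t1 t2] := frame_tangent (Lambda_smooth k) kx.
    have o := frame_orthonormal (Lambda_smooth k) kx.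
    have /eqP[] := timelike_inner_neq t1 t2 tTx o (tT x).
    by move: e => /eqP; rewrite mulf_eq0 invr_eq0 pnatr_eq0 => /eqP.
  have [sr si] := sf k 1 0; move: n0.
  rewrite [LHS]nablaS_coord1 => /complex0 [er ei].
  rewrite (dirderivV kx _ (sn k) (lt0r_neq0 (f0 k x kx))) (dirderiv_sqnorm kx _ sr si).
  rewrite (sqnorm_flow er ei) -/(sqnorm _) /h; have := lt0r_neq0 (f0 k x kx).
  by move: (sqnorm _) (connection_form _ _ _ _) => m w m0; field.
Qed.

Section ParallelFrame.
Variables (s : M -> @frame R M) (hs : frame_section g s).
Hypothesis s0 : forall x, connection_form g s (Xof s x) x = 0.
Let Sp := trivial_spin_structure hs.

Definition const_spinor (w : @spinor_module R) (x : M) : set (Q Sp * @spinor_module R) :=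
  spinor_class (trivial_sigma tt x : Q Sp) w.

Lemma sframe_trivial (k : triv_index Sp) : sframe k = s.
Proof. exact: trivial_Lambda_sigma. Qed.

Lemma const_spinor_field w : spinor_field (const_spinor w).
Proof.
case; exists (cst w); split=> // i j.
by split; apply: smooth_fun_on_cst; exact: openT.
Qed.

(** [harmonic] and [twistor] quantify over all coordinate functions; since the trivializing set is
    all of [M], the constant one is the only candidate. *)
Lemma const_spinor_coord w k f : spinor_coord (const_spinor w) k f -> f = cst w.
Proof.
by case: k => fw; apply/funext => x; apply/esym/spinor_class_inj/fw.
Qed.

Lemma const_spinorP w x q w' : const_spinor w x (q, w') ->
  exists al be : R, [/\ al != 0, be != 0, w' 0 0 = al%:C%C * w 0 0 & w' 1 0 = be%:C%C * w 1 0].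
Proof.
move=> [a [/SpinP[al [be [-> /spin_neq0[al0 be0]]]] [_ ->]]].
exists al^-1, be^-1; rewrite !invr_eq0 invmx_diag2 //.
by split=> //; rewrite !(mxE, sum2E) /=; ring.
Qed.

Lemma nablaS_const_coord0 k v (w : @spinor_module R) x : connection_form g s v x = 0 \/ w 0 0 = 0 ->
  @nablaS R M g Sp k v (cst w) x 0 0 = 0.
Proof.
move=> E; rewrite [LHS]nablaS_coord0 sframe_trivial /dirderiv !derive_cst !add0r.
by case: E => ->; rewrite ?mulr0 ?mul0r.
Qed.

Lemma nablaS_const_coord1 k v (w : @spinor_module R) x : connection_form g s v x = 0 \/ w 1 0 = 0 ->
  @nablaS R M g Sp k v (cst w) x 1 0 = 0.
Proof.
move=> E; rewrite [LHS]nablaS_coord1 sframe_trivial /dirderiv !derive_cst !add0r.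
by case: E => ->; rewrite ?mulr0 ?mul0r.
Qed.

Lemma csmooth_cst (w : @spinor_module R) (k : triv_index Sp) : csmooth_on (triv k) (cst w).
Proof. by move=> i j; split; apply: smooth_fun_on_cst; exact: openT. Qed.

Lemma Dirac_const_coord1 (k : triv_index Sp) (w : @spinor_module R) x : Dirac k (cst w) x 1 0 = 0.
Proof.
rewrite (@Dirac_coord1_Xof _ _ _ Sp k _ x I (csmooth_cst w k)).
by rewrite nablaS_const_coord0 ?mulr0 //; left; rewrite sframe_trivial.
Qed.

(** The upper component of D only sees the second entry, which is 0; the lower one is a derivative
    along X_s, where the connection form vanishes. *)
Lemma const_spinor_harmonic (w : @spinor_module R) : w 1 0 = 0 -> harmonic (const_spinor w).
Proof.
move=> w1 k f /const_spinor_coord -> x _; apply: spinor_eq0; last exact: Dirac_const_coord1.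
rewrite [LHS]Dirac_coord0 [X in _ * (X - _)]nablaS_const_coord1; last by right.
by rewrite [X in _ * (_ - X)]nablaS_const_coord1 ?subrr ?mulr0 //; right.
Qed.

(** In the first component both sides vanish, as the lower component of D is 0. In the second, the
    residual is a multiple of the derivative along X_s, which is 0. *)
Lemma const_spinor_twistor (w : @spinor_module R) : w 0 0 = 0 -> twistor (const_spinor w).
Proof.
move=> w0 k f /const_spinor_coord -> V vV x kx; apply: spinor_ext; rewrite [RHS]mxE.
  rewrite [LHS]nablaS_const_coord0; last by right.
  by rewrite [X in _ * X]clifford_mul_coord0 [X in _ * (_ * X)]Dirac_const_coord1 !mulr0.
have move_half (a h b : R[i]) : a + h * b = 0 -> a = - h * b.
  by move/eqP; rewrite addr_eq0 mulNr => /eqP.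
have tV : tangent x (V x) by exact: vV.1.
apply: move_half; rewrite [LHS](@twistor_residual _ _ _ Sp k _ x kx (csmooth_cst w k) _ tV).
by rewrite [X in _ * X]nablaS_const_coord1 ?mulr0 //; left; rewrite sframe_trivial.
Qed.

End ParallelFrame.

Lemma parallel_frame_harmonic s : frame_section g s ->
  (forall x, connection_form g s (Xof s x) x = 0) ->
  exists (Sp : spin_structure g) varphi, [/\ @spinor_field R M g Sp varphi,
    positive_spinor varphi, harmonic varphi & without_zeros varphi].
Proof.
move=> hs s0; pose w : @spinor_module R := delta_mx 0 0.
exists (trivial_spin_structure hs), (const_spinor (hs := hs) w); split.
- exact: const_spinor_field.
- move=> x q w' /const_spinorP [al [be [_ _ _ e]]]; apply/clomega_positive.
  by rewrite e mxE /= mulr0.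
- by apply: const_spinor_harmonic => //; rewrite mxE.
- move=> x q w' /const_spinorP [al [be [al0 _ e _]]] w0; move: e; rewrite w0 !mxE /= mulr1.
  by move/esym/eqP; rewrite -(rmorph0 (real_complex R)) (inj_eq (@complexI R)) (negbTE al0).
Qed.

Lemma parallel_frame_twistor s : frame_section g s ->
  (forall x, connection_form g s (Xof s x) x = 0) ->
  exists (Sp : spin_structure g) varphi, [/\ @spinor_field R M g Sp varphi,
    negative_spinor varphi, twistor varphi & without_zeros varphi].
Proof.
move=> hs s0; pose w : @spinor_module R := delta_mx 1 0.
exists (trivial_spin_structure hs), (const_spinor (hs := hs) w); split.
- exact: const_spinor_field.
- move=> x q w' /const_spinorP [al [be [_ _ e _]]]; apply/clomega_negative.
  by rewrite e mxE /= mulr0.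
- by apply: const_spinor_twistor => //; rewrite mxE.
- move=> x q w' /const_spinorP [al [be [_ be0 _ e]]] w0; move: e; rewrite w0 !mxE /= mulr1.
  by move/esym/eqP; rewrite -(rmorph0 (real_complex R)) (inj_eq (@complexI R)) (negbTE be0).
Qed.

End ChiralSpinors.

(** * The cycle of implications among the six assertions *)

Theorem proposition4p38 (R : realType) (M : surface R) (g : lorentz_metric M)
    (hM : time_orientable g) :
  [<-> (* i *)   X_conformally_flat g;
       (* ii *)  exists s, frame_section g s /\
                   forall x, divergence g (Xof s) x = 0;
       (* iii *) exists X, nonvanishing_Xfield g X /\
                   forall x, divergence g X x = 0;
       (* iv *)  exists s, frame_section g s /\ forall x,
                   nablaLC g (Xof s x) (fun z => (s z).1) x = 0 /\
                   nablaLC g (Xof s x) (fun z => (s z).2) x = 0;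
       (* v *)   exists (Sp : spin_structure g) varphi,
                   [/\ @spinor_field R M g Sp varphi, positive_spinor varphi,
                       harmonic varphi & without_zeros varphi];
       (* vi *)  exists (Sp : spin_structure g) varphi,
                   [/\ @spinor_field R M g Sp varphi, negative_spinor varphi,
                       twistor varphi & without_zeros varphi] ].
Proof.
(* The common return from a divergence-free null field to a frame, shared by the last four
   implications except (iv) to (v). *)
have frame_of : (exists X, nonvanishing_Xfield g X /\ forall x, divergence g X x = 0) ->
    exists s, frame_section g s /\ forall x, connection_form g s (Xof s x) x = 0.
  move=> [X [hX dX]]; have [s [hs XE]] := frame_of_Xfield hM hX.
  by exists s; split=> // x; rewrite -(divergence_Xof openT hs I) XE.
tfae.
- by case.
- move=> [s [hs ds]]; exists (Xof s); split=> //; split; first exact: Xof_field openT hs.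
  move=> x; have [X0 _] := Xof_lightlike hs (I : [set: M] x); split=> //.
  by rewrite -[Xof s x]scale1r; apply: (Xof_Xdistribution hs) => //; exact: oner_neq0.
- move=> /frame_of [s [hs s0]]; exists s; split=> // x.
  by apply: (nablaLC_frame_eq0 openT hs) (s0 x).
- move=> [s [hs s0]]; apply: (parallel_frame_harmonic hs) => x.
  rewrite /connection_form (s0 x).1 -[X in inner _ _ X _](scale0r ((s x).1)).
  by rewrite innerZl mul0r.
(* The harmonic spinor only yields a frame with w(X_s) = 0; the twistor spinor then lives in the
   trivial spin structure of that frame, which may differ from [Sp]. *)
- move=> [Sp [varphi [sv pv hv nv]]].
  have [s [hs s0]] := frame_of (harmonic_Xfield hM sv pv hv nv).
  exact: parallel_frame_twistor hs s0.
- move=> [Sp [varphi [sv pv hv nv]]]; split=> //.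
  have [s [hs s0]] := frame_of (twistor_Xfield hM sv pv hv nv).
  by exists s; split=> // x; rewrite (divergence_Xof openT hs I).
Qed.
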